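(* Let $q_i:\mathbb R^n\to\mathbb R$, $i\in E\cup I$, be twice continuously differentiable, where $E=\{1,\dots,\ell_1\}$, $I=\{\ell_1+1,\dots,\ell_1+\ell_2\}$, $\ell=\ell_1+\ell_2$, $E\cup I\neq\emptyset$, $q=(q_1,\dots,q_\ell)$, $\Theta=\{0_{\mathbb R^{\ell_1}}\}\times\mathbb R_-^{\ell_2}$ and $\Gamma=\{x\in\mathbb R^n\mid q(x)\in\Theta\}$. Suppose that RCRCQ holds at $\bar x\in\Gamma$. Then there exist an open neighborhood $U$ of $\bar x$ and a real number $\gamma>0$ such that MSCQ holds at every point $x\in\Gamma\cap U$ with modulus $\gamma$, and moreover: (i) For every $x\in\Gamma\cap U$ and all $x^*,v\in\mathbb R^n$ satisfying $\langle\nabla q_i(x),v\rangle=0$ for all $i\in E\cup I^+(x,x^* )$, we have $\Lambda(x,x^*;v)=\Lambda(x,x^* )$. (ii) For every $x\in\Gamma\cap U$, $x^*\in\mathbb R^n$ and $\lambda\in\Lambda(x,x^* )$, $$T_{\mathrm{gph}\,N_\Gamma}(x,x^* )=\big\{(w,z)\in\mathbb R^{2n}\mid z\in\nabla^2\langle\lambda,q\rangle(x)w+N_{K(x,x^* )}(w)\big\},$$ equivalently $DN_\Gamma(x,x^* )(w)=\nabla^2\langle\lambda,q\rangle(x)w+N_{K(x,x^* )}(w)$ for all $w\in\mathbb R^n$. (iii) For every $x\in\Gamma\cap U$ and $x^*\in\mathbb R^n$ with $\Lambda(x,x^* )\neq\emptyset$, there exists $\lambda\in\Lambda(x,x^*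 )$ with $\|\lambda\|\le\gamma\|x^*\|$ such that $z\in\nabla^2\langle\lambda,q\rangle(x)w+N_{K(x,x^* )}(w)$ whenever $w\in\mathbb R^n$ and $z\in DN_\Gamma(x,x^* )(w)$.
   Context: For $x\in\Gamma$, $I(x)=\{i\in I\mid q_i(x)=0\}$ is the active index set. RCRCQ holds at $\bar x\in\Gamma$ if there is a neighborhood $V$ of $\bar x$ such that for every $J\subseteq I(\bar x)$ the family $\{\nabla q_i(x)\mid i\in E\cup J\}$ has the same rank for all $x\in V$. MSCQ holds at $x\in\Gamma$ with modulus $\gamma>0$ if there is a neighborhood $W$ of $x$ with $d(u;\Gamma)\le\gamma\, d(q(u);\Theta)$ for all $u\in W$. $\nabla^2\langle\lambda,q\rangle(x)=\sum_i\lambda_i\nabla^2q_i(x)$. Tangent cone: $T_\Omega(\bar z)=\{u\mid\exists t_k\downarrow0,u_k\to u,\ \bar z+t_ku_k\in\Omega\}$. Regular normal cone $\widehat N_\Omega(z)=\{z^*\mid\limsup_{y\to z, y\in\Omega}\langle z^*,y-z\rangle/\|y-z\|\le0\}$; limiting normal cone $N_\Omega(\bar z)$ = set of limits of $z_k^*\in\widehat N_\Omega(z_k)$ with $z_k\to\bar z$, $z_k\in\Omega$ (empty if $\bar z\notin\Omega$). For a set-valued map $\Phi$, the graphical derivative is $D\Phi(x,y)(u)=\{v\mid(u,v)\in T_{\mathrm{gph}\Phi}(x,y)\}$. For $x\in\Gamma$ and $x^*\in\mathbb R^n$: $\Lambda(x,x^* )=\{\lambda\in\mathbb R^\ell\mid\sum_{i\in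 E\cup I}\lambda_i\nabla q_i(x)=x^*,\ \lambda_i\ge0,\ \lambda_iq_i(x)=0\ (i\in I)\}$; $I^+(\lambda)=\{i\in I\mid\lambda_i>0\}$; $I^+(x,x^* )=\bigcup_{\lambda\in\Lambda(x,x^* )}I^+(\lambda)$; $K(x,x^* )=T_\Gamma(x)\cap\{x^*\}^\perp$ (critical cone); for $v\in\mathbb R^n$, $\Lambda(x,x^*;v)=\mathrm{argmax}\{\langle v,\nabla^2\langle\lambda,q\rangle(x)v\rangle\mid\lambda\in\Lambda(x,x^* )\}$. *)

(* Defs.v *)
From HB Require Import structures.
From mathcomp Require Import all_boot all_order all_algebra.
From mathcomp Require Import boolp classical_sets reals.
Set Implicit Arguments. Unset Strict Implicit. Unset Printing Implicit Defensive.
Import Order.TTheory GRing.Theory Num.Theory.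
Local Open Scope ring_scope.
Local Open Scope classical_set_scope.

Definition vdot (R : realType) (m : nat) (u v : 'cV[R]_m) : R :=
  \sum_(i < m) u i 0 * v i 0.
Definition vnorm (R : realType) (m : nat) (u : 'cV[R]_m) : R :=
  Num.sqrt (vdot u u).
Definition dist (R : realType) (m : nat) (A : set 'cV[R]_m) (u : 'cV[R]_m) : R :=
  inf [set vnorm (u - y) | y in A].

Definition seq_cvg (R : realType) (m : nat) (u : nat -> 'cV[R]_m) (a : 'cV[R]_m) :=
  forall eps : R, 0 < eps -> exists N : nat, forall k, (N <= k)%N -> vnorm (u k - a) < eps.
Definition rseq_cvg0 (R : realType) (t : nat -> R) :=
  forall eps : R, 0 < eps -> exists N : nat, forall k, (N <= k)%N -> `|t k| < eps.

Definition tcone (R : realType) (m : nat) (A : set 'cV[R]_m) (z : 'cV[R]_m) : set 'cV[R]_m :=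
  [set u | exists (t : nat -> R) (uk : nat -> 'cV[R]_m),
      [/\ (forall k, 0 < t k), rseq_cvg0 t, seq_cvg uk u & forall k, A (z + t k *: uk k)]].

(* tangent cone to a subset S of R^m x R^m at p (convergence in R^{2m} is
   componentwise convergence) *)
Definition tcone2 (R : realType) (m : nat) (S : set ('cV[R]_m * 'cV[R]_m))
    (p : 'cV[R]_m * 'cV[R]_m) : set ('cV[R]_m * 'cV[R]_m) :=
  [set uv | exists (t : nat -> R) (uk vk : nat -> 'cV[R]_m),
      [/\ (forall k, 0 < t k), rseq_cvg0 t, seq_cvg uk uv.1, seq_cvg vk uv.2
        & forall k, S (p.1 + t k *: uk k, p.2 + t k *: vk k)]].

Definition gph (R : realType) (m : nat) (Phi : 'cV[R]_m -> set 'cV[R]_m) :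
    set ('cV[R]_m * 'cV[R]_m) := [set p | Phi p.1 p.2].
Definition gderiv (R : realType) (m : nat) (Phi : 'cV[R]_m -> set 'cV[R]_m)
    (x y u : 'cV[R]_m) : set 'cV[R]_m :=
  [set v | tcone2 (gph Phi) (x, y) (u, v)].

Definition rnormal (R : realType) (m : nat) (A : set 'cV[R]_m) (z : 'cV[R]_m) : set 'cV[R]_m :=
  [set zs | forall eps : R, 0 < eps -> exists del : R, 0 < del /\
      forall y, A y -> vnorm (y - z) < del -> vdot zs (y - z) <= eps * vnorm (y - z)].

Definition lnormal (R : realType) (m : nat) (A : set 'cV[R]_m) (zb : 'cV[R]_m) : set 'cV[R]_m :=
  [set zs | A zb /\ exists (zk zsk : nat -> 'cV[R]_m),
      [/\ (forall k, A (zk k)), seq_cvg zk zb, (forall k, rnormal A (zk k) (zsk k))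
        & seq_cvg zsk zs]].

Definition is_gradient (R : realType) (n : nat) (f : 'cV[R]_n -> R) (g x : 'cV[R]_n) :=
  forall eps : R, 0 < eps -> exists del : R, 0 < del /\
    forall y, vnorm (y - x) < del -> `|f y - f x - vdot g (y - x)| <= eps * vnorm (y - x).
Definition is_jacobian (R : realType) (n : nat) (G : 'cV[R]_n -> 'cV[R]_n) (H : 'M[R]_n)
    (x : 'cV[R]_n) :=
  forall eps : R, 0 < eps -> exists del : R, 0 < del /\
    forall y, vnorm (y - x) < del -> vnorm (G y - G x - H *m (y - x)) <= eps * vnorm (y - x).
Definition mx_continuous (R : realType) (n : nat) (F : 'cV[R]_n -> 'M[R]_n) :=
  forall x eps, 0 < eps -> exists del : R, 0 < del /\
    forall y, vnorm (y - x) < del -> forall i j, `|F y i j - F x i j| < eps.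

(* ---------- The constraint system ----------
   indices 'I_(l1 + l2): i < l1 is E, l1 <= i is I. *)
Section Constraints.
Variables (R : realType) (n l1 l2 : nat).
Variable q : 'I_(l1 + l2) -> 'cV[R]_n -> R.
Variable dq : 'I_(l1 + l2) -> 'cV[R]_n -> 'cV[R]_n.
Variable d2q : 'I_(l1 + l2) -> 'cV[R]_n -> 'M[R]_n.

Definition qv (x : 'cV[R]_n) : 'cV[R]_(l1 + l2) := \col_i q i x.

Definition Theta : set 'cV[R]_(l1 + l2) :=
  [set y | forall i : 'I_(l1 + l2), if (i < l1)%N then y i 0 = 0 else y i 0 <= 0].

Definition Gamma : set 'cV[R]_n := [set x | Theta (qv x)].

Definition active (x : 'cV[R]_n) : {set 'I_(l1 + l2)} :=
  [set i : 'I_(l1 + l2) | (l1 <= i)%N && (q i x == 0)].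

(* matrix whose rows are the grad q_i(x), i in E u J (other rows zero);
   its rank is the rank of the family {grad q_i(x) | i in E u J} *)
Definition gradmx (J : {set 'I_(l1 + l2)}) (x : 'cV[R]_n) : 'M[R]_(l1 + l2, n) :=
  \matrix_(i, j) (if (i < l1)%N || (i \in J) then dq i x j 0 else 0).

Definition RCRCQ (xb : 'cV[R]_n) :=
  exists r : R, 0 < r /\
    forall J : {set 'I_(l1 + l2)}, J \subset active xb ->
      forall x, vnorm (x - xb) < r -> \rank (gradmx J x) = \rank (gradmx J xb).

Definition MSCQ (x : 'cV[R]_n) (gam : R) :=
  exists r : R, 0 < r /\
    forall u, vnorm (u - x) < r -> dist Gamma u <= gam * dist Theta (qv u).

Definition Lagr (x xs : 'cV[R]_n) : set 'cV[R]_(l1 + l2) :=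
  [set lam | \sum_i lam i 0 *: dq i x = xs /\
     forall i : 'I_(l1 + l2), (l1 <= i)%N -> 0 <= lam i 0 /\ lam i 0 * q i x = 0].

Definition Iplus (x xs : 'cV[R]_n) : set 'I_(l1 + l2) :=
  [set i : 'I_(l1 + l2) | (l1 <= i)%N /\ exists2 lam, Lagr x xs lam & 0 < lam i 0].

Definition hessL (lam : 'cV[R]_(l1 + l2)) (x : 'cV[R]_n) : 'M[R]_n :=
  \sum_i lam i 0 *: d2q i x.

Definition critcone (x xs : 'cV[R]_n) : set 'cV[R]_n :=
  [set w | tcone Gamma x w /\ vdot xs w = 0].

Definition LagrV (x xs v : 'cV[R]_n) : set 'cV[R]_(l1 + l2) :=
  [set lam | Lagr x xs lam /\ forall mu, Lagr x xs mu ->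
      vdot v (hessL mu x *m v) <= vdot v (hessL lam x *m v)].

Definition NGamma : 'cV[R]_n -> set 'cV[R]_n := lnormal Gamma.

End Constraints.

(* Main.v *)
Require Import Defs.
From HB Require Import structures.
From mathcomp Require Import all_boot all_order all_algebra.
From mathcomp Require Import boolp classical_sets reals.
From mathcomp Require Import filter topology normedtype sequences derive realfun.
From mathcomp Require Import ring lra.
Set Implicit Arguments. Unset Strict Implicit. Unset Printing Implicit Defensive.
Import Order.TTheory GRing.Theory Num.Theory.
Import numFieldNormedType.Exports.
Local Open Scope ring_scope.
Local Open Scope classical_set_scope.

(* Everything rests on one closedness property.  Under the constant rank
   condition, a conic combination of the active gradients at a point y near x can
   be rewritten (by a Caratheodory reduction to gradients that are independent at x)
   with multipliers bounded by a constant times the norm of the combination.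
   Hence limits of such combinations are combinations at x with the same sign
   pattern.

   Minimisers of |y - u|^2 + k * (squared violation) then converge to a feasible
   point p whose residual u - p is a combination with bounded multipliers; pairing
   u - p with itself gives the error bound, which is MSCQ.  The error bound shows
   that linearised directions are tangent, also for the system whose equalities
   are all constraints tight to first order along w.  Applied to linear
   constraints, the same projection yields Farkas' lemma, hence the normal cones
   to Gamma and to the critical cone.

   For (i), the quotients of sum_i eta_i grad q_i(x + t w) by t lie in the spans of
   the gradients, so H_eta w lies in the span at x whenever the combination
   vanishes at x.  For (ii), the difference quotient of multiplier representations
   of x* along the graph splits into H_lam w plus conic combinations at x + t w,
   whose limit is normal to the critical cone at w; conversely, moving along
   the tight constraints with multipliers lam + t mu realises every such pair. *)

(** * Inner product and Euclidean norm on column vectors *)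

Section EuclideanSpace.
Variables (R : realType) (m : nat).
Implicit Types (u v w : 'cV[R]_m) (a : R).

Lemma vdotC u v : vdot u v = vdot v u.
Proof. by apply: eq_bigr => i _; rewrite mulrC. Qed.

Lemma vdotDl u v w : vdot (u + v) w = vdot u w + vdot v w.
Proof. by rewrite -big_split; apply: eq_bigr => i _; rewrite mxE mulrDl. Qed.

Lemma vdotZl a u w : vdot (a *: u) w = a * vdot u w.
Proof. by rewrite mulr_sumr; apply: eq_bigr => i _; rewrite mxE mulrA. Qed.

Lemma vdotNl u w : vdot (- u) w = - vdot u w.
Proof. by rewrite -scaleN1r vdotZl mulN1r. Qed.

Lemma vdotBl u v w : vdot (u - v) w = vdot u w - vdot v w.
Proof. by rewrite vdotDl vdotNl. Qed.

Lemma vdotDr u v w : vdot w (u + v) = vdot w u + vdot w v.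
Proof. by rewrite vdotC vdotDl !(vdotC w). Qed.

Lemma vdotZr a u w : vdot w (a *: u) = a * vdot w u.
Proof. by rewrite vdotC vdotZl (vdotC w). Qed.

Lemma vdotNr u w : vdot w (- u) = - vdot w u.
Proof. by rewrite vdotC vdotNl (vdotC w). Qed.

Lemma vdotBr u v w : vdot w (u - v) = vdot w u - vdot w v.
Proof. by rewrite vdotDr vdotNr. Qed.

Lemma vdot0l w : vdot 0 w = 0.
Proof. by rewrite -(scale0r 0) vdotZl mul0r. Qed.

Lemma vdot0r w : vdot w 0 = 0.
Proof. by rewrite vdotC vdot0l. Qed.

Lemma vdot_suml (I : finType) (f : I -> 'cV[R]_m) w :
  vdot (\sum_i f i) w = \sum_i vdot (f i) w.
Proof.
by apply: (big_morph (fun u => vdot u w)) => [u v|]; rewrite ?vdotDl ?vdot0l.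
Qed.

Lemma vdot_ge0 u : 0 <= vdot u u.
Proof. by apply: sumr_ge0 => i _; rewrite -expr2 sqr_ge0. Qed.

Lemma vdot_eq0 u : vdot u u = 0 -> u = 0.
Proof.
move=> /eqP; rewrite psumr_eq0 => [/allP h|i _]; last by rewrite -expr2 sqr_ge0.
apply/colP => i; have := h i; rewrite mem_index_enum => /(_ isT).
by rewrite /= mulf_eq0 orbb mxE => /eqP.
Qed.

Lemma vnorm_ge0 u : 0 <= vnorm u.
Proof. exact: sqrtr_ge0. Qed.

Lemma vnorm_sqr u : vnorm u ^+ 2 = vdot u u.
Proof. by rewrite sqr_sqrtr ?vdot_ge0. Qed.

Lemma vnorm0 : vnorm (0 : 'cV[R]_m) = 0.
Proof. by rewrite /vnorm vdot0l sqrtr0. Qed.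

Lemma vnorm_eq0 u : vnorm u = 0 -> u = 0.
Proof. by move=> h; apply: vdot_eq0; rewrite -vnorm_sqr h expr0n. Qed.

Lemma vnormZ a u : vnorm (a *: u) = `|a| * vnorm u.
Proof.
by rewrite /vnorm vdotZl vdotZr mulrA -expr2 sqrtrM ?sqr_ge0 // sqrtr_sqr.
Qed.

Lemma vnormN u : vnorm (- u) = vnorm u.
Proof. by rewrite -scaleN1r vnormZ normrN1 mul1r. Qed.

Lemma vnormC u v : vnorm (u - v) = vnorm (v - u).
Proof. by rewrite -vnormN opprB. Qed.

(** Cauchy-Schwarz: [vdot v v *: u - vdot u v *: v] has nonnegative square, which factors as
    [vdot v v] times [vdot u u * vdot v v - vdot u v ^+ 2]. *)
Lemma vdot_norm u v : `|vdot u v| <= vnorm u * vnorm v.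
Proof.
have [v0|vn0] := eqVneq (vdot v v) 0.
  by rewrite (vdot_eq0 v0) vdot0r normr0 mulr_ge0 // vnorm_ge0.
have vp : 0 < vdot v v by rewrite lt_neqAle eq_sym vn0 vdot_ge0.
have := vdot_ge0 (vdot v v *: u - vdot u v *: v).
rewrite !(vdotBl, vdotBr, vdotZl, vdotZr) (vdotC v u).
set a := vdot u v; set b := vdot v v; set c := vdot u u.
move=> h0; have : 0 <= b * (c * b - a ^+ 2).
  by apply: le_trans h0 _; rewrite le_eqVlt; apply/orP; left; apply/eqP; ring.
rewrite pmulr_rge0 // subr_ge0 => h.
rewrite -sqrtrM ?vdot_ge0 // -/c -/b -(sqrtr_sqr a).
by rewrite ler_wsqrtr.
Qed.

Lemma vdot_le u v : vdot u v <= vnorm u * vnorm v.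
Proof. by apply: le_trans (vdot_norm u v); rewrite ler_norm. Qed.

Lemma vnormD u v : vnorm (u + v) <= vnorm u + vnorm v.
Proof.
have h0 : 0 <= vnorm u + vnorm v by rewrite addr_ge0 ?vnorm_ge0.
rewrite -(@ler_pXn2r _ 2) ?nnegrE ?vnorm_ge0 // vnorm_sqr.
rewrite vdotDl !vdotDr -!vnorm_sqr (vdotC v).
have := vdot_le u v; lra.
Qed.

Lemma vnorm_triangle w u v : vnorm (u - v) <= vnorm (u - w) + vnorm (w - v).
Proof. by have := vnormD (u - w) (w - v); rewrite addrA subrK. Qed.

Lemma coord_le_vnorm u i : `|u i 0| <= vnorm u.
Proof.
rewrite -sqrtr_sqr ler_wsqrtr // /vdot (bigD1 i) //= expr2 lerDl.
by apply: sumr_ge0 => j _; rewrite -expr2 sqr_ge0.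
Qed.

Lemma vnorm_le_sum u : vnorm u <= \sum_i `|u i 0|.
Proof.
rewrite -(@ler_pXn2r _ 2) ?nnegrE ?vnorm_ge0 ?sumr_ge0 //.
rewrite vnorm_sqr expr2 mulr_suml; apply: ler_sum => i _.
rewrite (le_trans (ler_norm _)) // normrM ler_wpM2l //.
by rewrite (bigD1 i) //= lerDl sumr_ge0.
Qed.

Lemma sum_le_vnorm u : \sum_i `|u i 0| <= m%:R * vnorm u.
Proof.
rewrite mulr_natl -[X in _ *+ X]card_ord -sumr_const.
by apply: ler_sum => i _; apply: coord_le_vnorm.
Qed.

End EuclideanSpace.

(** * Limits along a free ultrafilter *)

Lemma free_ultrafilter_ex :
  exists U : set_system nat, UltraFilter U /\ \oo `<=` U.
Proof. exact: ultraFilterLemma. Qed.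

(* Every bounded sequence converges along [ultra], so no subsequence is ever
   extracted. *)
Definition ultra : set_system nat := projT1 (cid free_ultrafilter_ex).

Instance ultra_ultra : UltraFilter ultra.
Proof. by rewrite /ultra; case: cid => U []. Qed.

Lemma eventually_ultra : \oo `<=` ultra.
Proof. by rewrite /ultra; case: cid => U []. Qed.

(** Coordinatewise convergence along [ultra]; in finite dimension it agrees with convergence in
    norm, as [vcvg_near] and [vcvg_eps] show. *)
Definition vcvg (R : realType) (m : nat) (u : nat -> 'cV[R]_m) (a : 'cV[R]_m) :=
  forall i, u k i 0 @[k --> ultra] --> a i 0.

Section UltraLimits.
Variable R : realType.

(** The image of [ultra] under [u] is an ultrafilter containing a compact segment, so it
    converges. *)
Lemma ultra_bounded_cvg (u : nat -> R) (M : R) :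
  (\forall k \near ultra, `|u k| <= M) -> exists a : R, u k @[k --> ultra] --> a.
Proof.
move=> hM.
have : compact `[- M, M] by exact: segment_compact.
rewrite compact_ultra => /(_ (u @ ultra) _ _)[].
- split; first exact: fmap_proper_filter.
  (* Maximality of the image: otherwise the complement of [A] would lie in the image, hence in the
     proper filter [G], which already contains [A]. *)
  move=> G PG sG; apply/seteqP; split => // A GA.
  have [//|h] := in_ultra_setVsetC (u @^-1` A) ultra_ultra.
  have /filter_ex[x []//] : G (A `&` ~` A) by apply: filterI => //; apply: sG.
- by apply: filterS hM => k /=; rewrite in_itv /= ler_norml.
- by move=> a [_ ha]; exists a.
Qed.

Lemma eventually_cvg0 (t : nat -> R) : rseq_cvg0 t -> t k @[k --> ultra] --> 0.
Proof.
move=> h; apply/cvgr0Pnorm_lt => e /h[N hN]; apply: eventually_ultra.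
by exists N.
Qed.

Lemma harmonic_ultra : (k.+1%:R^-1 : R) @[k --> ultra] --> 0.
Proof. by apply: cvg_trans (@cvg_harmonic R) => A hA; exact: eventually_ultra. Qed.

Lemma harmonic_near (e : R) : 0 < e -> \forall k \near ultra, k.+1%:R^-1 < e.
Proof. by move=> e0; exact: (cvgr_lt _ harmonic_ultra _ e0). Qed.

Lemma ultra_cvg_near_eq (u v : nat -> R) (a : R) :
  (\forall k \near ultra, u k = v k) ->
  u k @[k --> ultra] --> a -> v k @[k --> ultra] --> a.
Proof.
move=> h hu; apply: cvg_trans hu; apply: near_eq_cvg.
by apply: filterS h => k ->.
Qed.

Lemma ultra_cvg_sum (I : finType) (f : I -> nat -> R) (a : I -> R) :
  (forall i, f i k @[k --> ultra] --> a i) ->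
  \sum_i f i k @[k --> ultra] --> \sum_i a i.
Proof.
move=> h; elim: (index_enum I) => [|i r IH].
  by under eq_fun do rewrite big_nil; rewrite big_nil; apply: cvg_cst.
by under eq_fun do rewrite big_cons; rewrite big_cons; apply: cvgD.
Qed.

Section Vectors.
Variable m : nat.
Implicit Types (u v : nat -> 'cV[R]_m) (a b : 'cV[R]_m).

Lemma vcvg_bounded u M : (\forall k \near ultra, vnorm (u k) <= M) ->
  exists a, vcvg u a.
Proof.
move=> hM.
have /choice[a ha] : forall i, exists a : R, u k i 0 @[k --> ultra] --> a.
  move=> i; apply: (@ultra_bounded_cvg _ M); apply: filterS hM => k.
  exact: le_trans (coord_le_vnorm _ _).
by exists (\col_i a i) => i; rewrite mxE.
Qed.

Lemma vcvgD u v a b : vcvg u a -> vcvg v b -> vcvg (fun k => u k + v k) (a + b).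
Proof.
by move=> hu hv i; under eq_fun do rewrite mxE; rewrite mxE; apply: cvgD.
Qed.

Lemma vcvgZ (t : nat -> R) (s : R) u a : t k @[k --> ultra] --> s -> vcvg u a ->
  vcvg (fun k => t k *: u k) (s *: a).
Proof.
by move=> hu hv i; under eq_fun do rewrite mxE; rewrite mxE; apply: cvgM.
Qed.

Lemma vcvg_cst a : vcvg (fun=> a) a.
Proof. by move=> i; apply: cvg_cst. Qed.

Lemma vcvgB u v a b : vcvg u a -> vcvg v b -> vcvg (fun k => u k - v k) (a - b).
Proof.
by move=> hu hv i; under eq_fun do rewrite !mxE; rewrite !mxE; apply: cvgB.
Qed.

Lemma vcvg_sum (I : finType) (f : I -> nat -> 'cV[R]_m) (a : I -> 'cV[R]_m) :
  (forall i, vcvg (f i) (a i)) ->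
  vcvg (fun k => \sum_i f i k) (\sum_i a i).
Proof.
move=> h j; under eq_fun do rewrite summxE; rewrite summxE.
by apply: ultra_cvg_sum => i; apply: h.
Qed.

Lemma ultra_cvg_vdot u v a b : vcvg u a -> vcvg v b ->
  vdot (u k) (v k) @[k --> ultra] --> vdot a b.
Proof. by move=> hu hv; apply: ultra_cvg_sum => i; apply: cvgM. Qed.

Lemma ultra_cvg_vnorm u a : vcvg u a -> vnorm (u k) @[k --> ultra] --> vnorm a.
Proof.
move=> hu; apply: (@cvg_comp _ _ _ (fun k => vdot (u k) (u k)) Num.sqrt).
  by apply: ultra_cvg_vdot; exact: hu.
exact: sqrt_continuous.
Qed.

Lemma vcvg_near u a e : vcvg u a -> 0 < e ->
  \forall k \near ultra, vnorm (u k - a) < e.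
Proof.
move=> hu e0.
have h : vnorm (u k - a) @[k --> ultra] --> (0 : R).
  rewrite -(@vnorm0 _ m) -(subrr a); apply: ultra_cvg_vnorm.
  by apply: vcvgB => //; exact: vcvg_cst.
by apply: cvgr_lt h _ _.
Qed.

Lemma vcvg_eps u a : (forall e, 0 < e -> \forall k \near ultra, vnorm (u k - a) <= e) ->
  vcvg u a.
Proof.
move=> h i; apply/cvgrPdist_le => e /h; apply: filterS => k.
apply: le_trans; rewrite distrC; have := coord_le_vnorm (u k - a) i.
by rewrite !mxE.
Qed.

Lemma seq_cvg_vcvg u a : seq_cvg u a -> vcvg u a.
Proof.
move=> h; apply: vcvg_eps => e /h[N hN]; apply: eventually_ultra.
by exists N => // k /= /hN/ltW.
Qed.

Lemma vcvg_unique u a b : vcvg u a -> vcvg u b -> a = b.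
Proof.
by move=> ha hb; apply/colP => i; apply: (cvg_unique _ (ha i) (hb i)).
Qed.

Lemma vcvg_near_eq u v a : (\forall k \near ultra, u k = v k) -> vcvg u a -> vcvg v a.
Proof.
move=> h hu i; apply: ultra_cvg_near_eq (hu i).
by apply: filterS h => k ->.
Qed.

End Vectors.
End UltraLimits.

(** * Multipliers under the constant rank condition *)

Definition vcontinuous (R : realType) (n p : nat) (f : 'cV[R]_n -> 'cV[R]_p)
    (x : 'cV[R]_n) :=
  forall e, 0 < e -> exists d : R, 0 < d /\
    forall y, vnorm (y - x) < d -> vnorm (f y - f x) <= e.

Lemma vcvg_continuous (R : realType) (n p : nat) (f : 'cV[R]_n -> 'cV[R]_p) x y :
  vcontinuous f x -> vcvg y x -> vcvg (fun k => f (y k)) (f x).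
Proof.
move=> hf hy; apply: vcvg_eps => e /hf[d [d0 hd]].
by apply: filterS (vcvg_near hy d0) => k; apply: hd.
Qed.

Section ConstantRank.
Variables (R : realType) (n m : nat) (g : 'I_m -> 'cV[R]_n -> 'cV[R]_n).
Implicit Types (F A B J S T : {set 'I_m}) (x y : 'cV[R]_n) (mu : 'cV[R]_m).

Definition comb y mu : 'cV[R]_n := \sum_i mu i 0 *: g i y.

Definition supp_in S mu := forall i, i \notin S -> mu i 0 = 0.

(** The multipliers of a system with equalities [F] and inequalities [A]; an index in both sets
    counts as an equality. *)
Definition mcone F A mu :=
  supp_in (F :|: A) mu /\ forall i, i \notin F -> 0 <= mu i 0.

(** Rows outside [S] are zeroed rather than removed, so all index sets share one matrix type. *)
Definition grad_rows S y : 'M[R]_(m, n) :=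
  \matrix_(i, j) (if i \in S then g i y j 0 else 0).

Definition indep S y := forall mu, supp_in S mu -> comb y mu = 0 -> mu = 0.

Definition const_rank F A x := exists r : R, 0 < r /\
  forall B, B \subset A -> forall y, vnorm (y - x) < r ->
    \rank (grad_rows (F :|: B) y) = \rank (grad_rows (F :|: B) x).

Lemma comb_add y mu nu : comb y (mu + nu) = comb y mu + comb y nu.
Proof. by rewrite -big_split; apply: eq_bigr => i _; rewrite mxE scalerDl. Qed.

Lemma comb_scale y a mu : comb y (a *: mu) = a *: comb y mu.
Proof. by rewrite scaler_sumr; apply: eq_bigr => i _; rewrite mxE scalerA. Qed.

Lemma comb_sub y mu nu : comb y (mu - nu) = comb y mu - comb y nu.
Proof. by rewrite comb_add -scaleN1r comb_scale scaleN1r. Qed.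

Lemma vdot_comb y mu w : vdot (comb y mu) w = \sum_i mu i 0 * vdot (g i y) w.
Proof. by rewrite vdot_suml; apply: eq_bigr => i _; rewrite vdotZl. Qed.

Lemma comb_grad_rows S y mu : supp_in S mu ->
  (comb y mu)^T = mu^T *m grad_rows S y.
Proof.
move=> hS; apply/rowP => j; rewrite !mxE summxE; apply: eq_bigr => i _.
by rewrite !mxE; case: ifP => // /negbT/hS ->; rewrite !mul0r.
Qed.

Lemma grad_rows_comb S y (v : 'rV[R]_m) :
  exists2 mu, supp_in S mu & (comb y mu)^T = v *m grad_rows S y.
Proof.
have hS : supp_in S (\col_i (if i \in S then v 0 i else 0)).
  by move=> i /negbTE; rewrite mxE => ->.
exists (\col_i (if i \in S then v 0 i else 0)) => //.
rewrite (comb_grad_rows _ hS); apply/rowP => j; rewrite !mxE.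
by apply: eq_bigr => i _; rewrite !mxE; case: ifP; rewrite ?mulr0.
Qed.

Lemma grad_rows_sub S T y mu : (grad_rows S y <= grad_rows T y)%MS ->
  supp_in S mu -> exists2 nu, supp_in T nu & comb y nu = comb y mu.
Proof.
move=> /submxP[D hD] hS; have [nu hT hnu] := grad_rows_comb T y (mu^T *m D).
exists nu => //; apply: trmx_inj.
by rewrite hnu (comb_grad_rows _ hS) hD mulmxA.
Qed.

Lemma grad_rows_mono S T y : S \subset T -> (grad_rows S y <= grad_rows T y)%MS.
Proof.
move=> sST; apply/row_subP => i; have [iS|iS] := boolP (i \in S); last first.
  by rewrite (_ : row _ _ = 0) ?sub0mx //; apply/rowP => j; rewrite !mxE (negbTE iS).
rewrite (_ : row _ _ = row i (grad_rows T y)) ?row_sub //.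
by apply/rowP => j; rewrite !mxE iS (fintype.subsetP sST).
Qed.

(** Dropping the zero rows turns independence of the family into [row_free], a statement about
    rank. *)
Let enum_rows S y : 'M[R]_(#|S|, n) :=
  rowsub (fun k : 'I_#|S| => enum_val k) (grad_rows S y).

Let enum_rowsE S y : \rank (enum_rows S y) = \rank (grad_rows S y).
Proof.
apply/eqP; rewrite eqn_leq; apply/andP; split; apply: mxrankS; apply/row_subP => i.
  by rewrite /enum_rows row_rowsub row_sub.
have [iS|iS] := boolP (i \in S); last first.
  by rewrite (_ : row _ _ = 0) ?sub0mx //; apply/rowP => j; rewrite !mxE (negbTE iS).
rewrite (_ : row _ _ = row (enum_rank_in iS i) (enum_rows S y)) ?row_sub //.
by rewrite /enum_rows row_rowsub enum_rankK_in.
Qed.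

Lemma rank_grad_rows_le S y : (\rank (grad_rows S y) <= #|S|)%N.
Proof. by rewrite -enum_rowsE rank_leq_row. Qed.

Lemma indepP S y : indep S y <-> \rank (grad_rows S y) = #|S|.
Proof.
rewrite -enum_rowsE; split=> [hS|/eqP hS].
  apply/eqP; apply: inj_row_free => v.
  set P : 'M[R]_(#|S|, m) := rowsub (fun k : 'I_#|S| => enum_val k) 1%:M.
  have -> : enum_rows S y = P *m grad_rows S y by rewrite mul_rowsub_mx mul1mx.
  rewrite mulmxA => hv.
  have hs : supp_in S (v *m P)^T.
    move=> i iS; rewrite !mxE big1 // => k _; rewrite !mxE.
    case: eqP => [ki|_]; last by rewrite mulr0.
    by case/negP: iS; rewrite -ki enum_valP.
  have /(congr1 trmx) : (v *m P)^T = 0.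
    by apply: hS => //; apply: trmx_inj; rewrite (comb_grad_rows _ hs) trmxK hv trmx0.
  rewrite trmxK trmx0 => hP; apply/rowP => k.
  have /rowP/(_ (enum_val k)) := hP; rewrite !mxE (bigD1 k) //= big1 ?addr0.
    by rewrite !mxE eqxx mulr1.
  move=> j jk; rewrite !mxE; case: eqP => [/enum_val_inj e|_]; last by rewrite mulr0.
  by rewrite e eqxx in jk.
move=> mu hs hc.
have hv : (\row_k mu (enum_val k) 0 : 'rV[R]_#|S|) *m enum_rows S y = 0.
  apply/rowP => j; rewrite !mxE.
  have /colP/(_ j) := hc; rewrite summxE mxE => e; rewrite -[RHS]e.
  rewrite [RHS](bigID (fun i => i \in S)) /= [X in _ = _ + X]big1 ?addr0; last first.
    by move=> i /hs ->; rewrite scale0r mxE.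
  rewrite [RHS]big_enum_val /=; apply: eq_bigr => k _.
  by rewrite !mxE enum_valP.
have /rowP hv0 : (\row_k mu (enum_val k) 0 : 'rV[R]_#|S|) = 0.
  by apply: (row_free_inj (A := enum_rows S y)) => //; rewrite hv mul0mx.
apply/colP => i; rewrite mxE; have [iS|/hs//] := boolP (i \in S).
by have := hv0 (enum_rank_in iS i); rewrite !mxE enum_rankK_in.
Qed.

(** A maximal free family of rows serves; its indices lie in [F] because the other rows are zero. *)
Lemma indep_basis F x : exists F', [/\ F' \subset F, indep F' x
  & (grad_rows F x <= grad_rows F' x)%MS].
Proof.
set M := grad_rows F x; set f := maxrankfun M.
have fF (k : 'I_(\rank M)) : f k \in F.
  apply: contraT => kF.
  have := @row_free_inj _ 1 _ _ _ (maxrowsub_free M) (delta_mx 0 k) 0.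
  rewrite -rowE row_rowsub mul0mx => H.
  have /H/rowP/(_ k)/eqP : row (f k) M = 0.
    by apply/rowP => j; rewrite !mxE (negbTE kF).
  by rewrite !mxE !eqxx oner_eq0.
exists [set f k | k in 'I_(\rank M)]%SET.
have hs : (M <= grad_rows [set f k | k in 'I_(\rank M)]%SET x)%MS.
  rewrite -(eq_maxrowsub M); apply/row_subP => k; rewrite row_rowsub.
  rewrite (_ : row _ _ = row (f k) (grad_rows [set f k | k in 'I_(\rank M)]%SET x)).
    exact: row_sub.
  by apply/rowP => j; rewrite !mxE fF imset_f.
split => //; first by apply/fintype.subsetP => i /imsetP[k _ ->].
apply/indepP/eqP; rewrite eqn_leq rank_grad_rows_le /=.
by apply: leq_trans (leq_imset_card _ _) _; rewrite card_ord; apply: mxrankS.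
Qed.

(* One multiplier in [J] is cancelled as long as the active gradients are
   dependent. *)
Lemma conic_caratheodory F J y mu : indep F y ->
  (forall i, i \in J -> i \notin F) -> mcone F J mu ->
  exists J' nu, [/\ J' \subset J, mcone F J' nu, comb y nu = comb y mu
    & indep (F :|: J') y].
Proof.
move=> hF; have [k hk] := ubnP #|J|; elim: k => // k IH in J mu hk *.
move=> nF [hs hp].
have [hJ|hJ] := pselect (indep (F :|: J) y).
  by exists J, mu; split.
have [al [als alc aln0]] :
    exists al, [/\ supp_in (F :|: J) al, comb y al = 0 & al != 0].
  move: hJ => /existsNP[al] /not_implyP[h1] /not_implyP[h2 /eqP h3].
  by exists al.
(* The dependence must involve [J], because the gradients in [F] are independent at [y]. *)
have [j0 [j0J aj0]] : exists j0, j0 \in J /\ al j0 0 != 0.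
  apply: contrapT => /forallNP h; case/negP: aln0; apply/eqP/hF => // i iF.
  have [iJ|iJ] := boolP (i \in J); last by apply: als; rewrite inE negb_or iF.
  by apply: contrapT => /eqP ai; apply: (h i).
(* Changing the sign of the relation makes some coefficient in [J] positive, so the ratios below
   range over a nonempty set. *)
wlog aj0p : al als alc aln0 aj0 / 0 < al j0 0.
  move=> H; have [lt0|le0] := ltP 0 (al j0 0); first exact: (H al).
  apply: (H (- al)).
  - by move=> i /als e; rewrite mxE e oppr0.
  - by rewrite -scaleN1r comb_scale alc scaler0.
  - by rewrite oppr_eq0.
  - by rewrite mxE oppr_eq0.
  - by rewrite mxE oppr_gt0 lt_neqAle aj0.
pose P i := (i \in J) && (0 < al i 0).
have Pj0 : P j0 by rewrite /P j0J.
(* Ratio test: the minimal ratio is the largest multiple of [al] that can be subtracted with the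
   multipliers in [J] still nonnegative, and it cancels the one at [j1]. *)
case: (Order.TotalTheory.arg_minP (fun i => mu i 0 / al i 0) Pj0).
move=> j1 /andP[j1J aj1] hmin.
set t := mu j1 0 / al j1 0 in hmin.
have t0 : 0 <= t by rewrite divr_ge0 ?hp ?nF // ltW.
have [|||J' [nu [sJ' h1 h2 h3]]] := IH (J :\ j1)%SET (mu - t *: al).
- by move: hk; rewrite (cardsD1 j1 J) j1J.
- by move=> i /setD1P[_ /nF].
- split=> i.
    rewrite !inE negb_or negb_and negbK => /andP[iF /orP[/eqP ->|iJ]].
      by rewrite !mxE /t divfK ?subrr // gt_eqF.
    by rewrite !mxE hs ?als ?mulr0 ?subr0 // inE negb_or iF.
  move=> iF; rewrite !mxE; have [iJ|iJ] := boolP (i \in J); last first.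
    by rewrite hs ?als ?mulr0 ?subr0 // inE negb_or iF.
  have [ai|ai] := ltP 0 (al i 0).
    by rewrite subr_ge0 -ler_pdivlMr // hmin // /P iJ.
  by rewrite subr_ge0 (@le_trans _ _ 0) ?hp // mulr_ge0_le0.
exists J', nu; split => //.
  exact: fintype.subset_trans sJ' (finset.subD1set _ _).
by rewrite h2 comb_sub comb_scale alc scaler0 subr0.
Qed.

Hypothesis g_cont : forall i x, vcontinuous (g i) x.

Lemma vcvg_comb (y : nat -> 'cV[R]_n) x (mu : nat -> 'cV[R]_m) nu :
  vcvg y x -> vcvg mu nu -> vcvg (fun k => comb (y k) (mu k)) (comb x nu).
Proof.
move=> hy hmu; apply: vcvg_sum => i; apply: vcvgZ; first exact: hmu.
exact: vcvg_continuous.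
Qed.

Lemma supp_in_cvg S (mu : nat -> 'cV[R]_m) nu : vcvg mu nu ->
  (\forall k \near ultra, supp_in S (mu k)) -> supp_in S nu.
Proof.
move=> hmu hS i iS.
apply/eqP; rewrite eq_le; apply/andP; split.
  by apply: (cvgr_to_le (hmu i)); apply: filterS hS => k /(_ i iS) ->.
by apply: (cvgr_to_ge (hmu i)); apply: filterS hS => k /(_ i iS) ->.
Qed.

Lemma mcone_cvg F A (mu : nat -> 'cV[R]_m) nu : vcvg mu nu ->
  (\forall k \near ultra, mcone F A (mu k)) -> mcone F A nu.
Proof.
move=> hmu hA; split.
  by apply: (supp_in_cvg hmu); apply: filterS hA => k [].
move=> i iF; apply: (cvgr_to_ge (hmu i)).
by apply: filterS hA => k [_ /(_ i iF)].
Qed.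

(** Compactness: normalised counterexamples at points tending to [x] would have a limit of norm 1
    that is a dependence at [x]. A single [c] gives both the bound and, through [c^-1], the
    radius. *)
Lemma indep_coercive S x : indep S x -> exists c : R, 0 < c /\
  forall y, vnorm (y - x) < c^-1 -> forall mu, supp_in S mu ->
    vnorm mu <= c * vnorm (comb y mu).
Proof.
move=> hS; apply: contrapT => /forallNP hn.
have /choice[p hp] : forall k : nat, exists p : 'cV[R]_n * 'cV[R]_m,
    [/\ vnorm (p.1 - x) < k.+1%:R^-1, supp_in S p.2
      & k.+1%:R * vnorm (comb p.1 p.2) < vnorm p.2].
  move=> k; have /not_andP[|] := hn k.+1%:R; first by rewrite ltr0n.
  move=> /existsNP[y] /not_implyP[h1] /existsNP[mu] /not_implyP[h2] /negP.
  by rewrite -ltNge => h3; exists (y, mu).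
have pos k : 0 < vnorm (p k).2.
  by have [_ _] := hp k; apply: le_lt_trans; rewrite mulr_ge0 ?vnorm_ge0.
pose nu k := (vnorm (p k).2)^-1 *: (p k).2.
have nu1 k : vnorm (nu k) = 1.
  by rewrite vnormZ gtr0_norm ?invr_gt0 // mulVf // gt_eqF.
have [mu hmu] : exists mu, vcvg nu mu.
  by apply: (@vcvg_bounded _ _ _ 1); apply: nearW => k; rewrite nu1.
have hy : vcvg (fun k => (p k).1) x.
  apply: vcvg_eps => e e0.
  by apply: filterS (harmonic_near e0) => k /ltW; apply: le_trans; have [/ltW] := hp k.
have c0 : vcvg (fun k => comb (p k).1 (nu k)) 0.
  apply: vcvg_eps => e e0.
  apply: filterS (harmonic_near e0) => k /ltW; apply: le_trans; have [_ _ h] := hp k.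
  rewrite subr0 /nu comb_scale vnormZ gtr0_norm ?invr_gt0 // mulrC.
  by rewrite ler_pdivrMr // ler_pdivlMl ?ltr0n // ltW.
have : mu = 0.
  apply: hS; last exact: vcvg_unique (vcvg_comb hy hmu) c0.
  apply: (supp_in_cvg hmu); apply: nearW => k i iS; have [_ /(_ i iS) h _] := hp k.
  by rewrite mxE h mulr0.
move=> mu0; have := ultra_cvg_vnorm hmu.
rewrite mu0 vnorm0 => h; have : (1 : R) <= 0.
  by apply: (cvgr_to_ge h); apply: nearW => k; rewrite nu1.
by rewrite ler10.
Qed.

(** There are finitely many index sets, and enlarging [c] both weakens the bound and shrinks the
    radius, so the sum of the constants works for all of them. *)
Lemma indep_coercive_unif x : exists c : R, 0 < c /\
  forall S, indep S x -> forall y, vnorm (y - x) < c^-1 -> forall mu, supp_in S mu ->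
    vnorm mu <= c * vnorm (comb y mu).
Proof.
have /choice[c hc] : forall S, exists c : R, 0 < c /\ (indep S x ->
    forall y, vnorm (y - x) < c^-1 -> forall mu, supp_in S mu ->
    vnorm mu <= c * vnorm (comb y mu)).
  move=> S; have [/indep_coercive[c [c0 hc]]|h] := pselect (indep S x).
    by exists c.
  by exists 1.
have cS S : c S <= \sum_S c S.
  by rewrite (bigD1 S) //= lerDl sumr_ge0 // => T _; apply/ltW/(hc T).1.
have cp : 0 < \sum_S c S by apply: lt_le_trans (cS finset.set0); apply: (hc _).1.
exists (\sum_S c S); split => // S hS y hy mu hmu.
apply: le_trans ((hc S).2 hS y _ mu hmu) _; last by rewrite ler_wpM2r ?vnorm_ge0.
by apply: lt_le_trans hy _; rewrite lef_pV2 ?posrE // (hc S).1.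
Qed.

(** The equalities are replaced by a basis [F'] chosen at [x], the inequalities are reduced at [y]
    to an independent family, and constant rank carries this independence back to [x], where one
    coercivity constant covers every independent set. *)
Lemma bounded_multipliers F A x : const_rank F A x -> exists c : R, 0 < c /\
  forall y, vnorm (y - x) < c^-1 -> forall B, B \subset A ->
  forall mu, mcone F B mu -> exists nu, [/\ mcone F B nu, comb y nu = comb y mu
    & vnorm nu <= c * vnorm (comb y mu)].
Proof.
move=> [r [r0 hr]]; have [c [c0 hc]] := indep_coercive_unif x.
have [F' [sF' hF' spF']] := indep_basis F x.
have cr0 : 0 < c + r^-1 by rewrite addr_gt0 // invr_gt0.
(* The summand [r^-1] puts the radius below both [c^-1] and [r]. *)
exists (c + r^-1); split => // y hy B sBA mu [mus mup].
have yc : vnorm (y - x) < c^-1.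
  by apply: lt_le_trans hy _; rewrite lef_pV2 ?posrE // lerDl invr_ge0 ltW.
have yr : vnorm (y - x) < r.
  apply: lt_le_trans hy _; rewrite -[leRHS]invrK lef_pV2 ?posrE ?invr_gt0 //.
  by rewrite lerDr ltW.
have F'y : indep F' y.
  move=> al als alc; apply: vnorm_eq0; apply/eqP; rewrite eq_le vnorm_ge0 andbT.
  by have := hc _ hF' _ yc _ als; rewrite alc vnorm0 mulr0.
(* [F'] still spans at [y]: the rank of [F] there equals its rank at [x], which is at most the size
   of [F'], and [F'] is independent at [y]. *)
have spy : (grad_rows F y <= grad_rows F' y)%MS.
  have /eqmxP -> : (grad_rows F' y == grad_rows F y)%MS; last exact: submx_refl.
  rewrite -(eq_leqif (mxrank_leqif_eq (grad_rows_mono y sF'))).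
  rewrite eqn_leq mxrankS ?grad_rows_mono //=.
  have := hr _ (finset.sub0set A) y yr; rewrite finset.setU0 => ->.
  apply: leq_trans (mxrankS spF') _; apply: leq_trans (rank_grad_rows_le _ _) _.
  by move/indepP: F'y => ->.
(* The part of [mu] on [F] is rewritten on [F']; the part on [B] outside [F] keeps its signs. *)
pose muF : 'cV[R]_m := \col_i (if i \in F then mu i 0 else 0).
have muFs : supp_in F muF by move=> i /negbTE; rewrite mxE => ->.
have [phi phis phic] := grad_rows_sub spy muFs.
pose mu1 := phi + (mu - muF).
have mu1c : comb y mu1 = comb y mu by rewrite comb_add comb_sub phic addrC subrK.
have dF i : i \in B :\: F -> i \notin F'.
  by rewrite inE => /andP[iF _]; apply: contraNN iF; apply: (fintype.subsetP sF').
have [|J' [nu [sJ' nuc nue nui]]] := conic_caratheodory F'y dF (mu := mu1).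
  split=> i; rewrite !(inE, mxE).
    rewrite negb_or => /andP[iF']; have [iF _|iF iB] := boolP (i \in F).
      by rewrite phis // subrr addr0.
    by rewrite phis // mus ?subr0 ?addr0 // inE negb_or iF.
  move=> iF'; rewrite phis // add0r; have [iF|iF] := boolP (i \in F).
    by rewrite subrr.
  by rewrite subr0 mup.
have sJ'B : J' \subset B by apply: fintype.subset_trans sJ' (finset.subsetDl _ _).
exists nu; split.
- have [nus nup] := nuc; split=> i; last first.
    by move=> iF; apply: nup; apply: contraNN iF; apply: (fintype.subsetP sF').
  rewrite inE negb_or => /andP[iF iB]; apply: nus; rewrite inE negb_or.
  by rewrite (contraNN (fintype.subsetP sF' i)) // (contraNN (fintype.subsetP sJ'B i)).
- by rewrite nue.
- rewrite -mu1c -nue; apply: le_trans (_ : c * vnorm (comb y nu) <= _); last first.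
    by rewrite ler_wpM2r ?vnorm_ge0 // lerDl invr_ge0 ltW.
  apply: (hc (F' :|: J')) => //; last by case: nuc.
  (* Independence passes from [y] to [x]: the size of [F' :|: J'] is its rank at [y], at most that
     of [F :|: J'] at [y], which equals its rank at [x], where [F' :|: J'] has the same span. *)
  apply/indepP/eqP; rewrite eqn_leq rank_grad_rows_le /=.
  move/indepP: nui => <-.
  apply: leq_trans (mxrankS (grad_rows_mono y (finset.setSU J' sF'))) _.
  rewrite hr ?(fintype.subset_trans sJ'B) //; apply/mxrankS/row_subP => i.
  have [iJ|iJ] := boolP (i \in J').
    rewrite (_ : row _ _ = row i (grad_rows (F' :|: J') x)) ?row_sub //.
    by apply/rowP => j; rewrite !mxE !inE iJ !orbT.
  apply: submx_trans (grad_rows_mono x (finset.subsetUl F' J')).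
  apply: submx_trans spF'.
  rewrite (_ : row _ _ = row i (grad_rows F x)) ?row_sub //.
  by apply/rowP => j; rewrite !mxE !inE (negbTE iJ) orbF.
Qed.

(** The multipliers [mu k] themselves may be unbounded; they are exchanged for bounded ones with the
    same combinations, which do have a limit. *)
Lemma comb_mcone_closed F A x (y : nat -> 'cV[R]_n) (mu : nat -> 'cV[R]_m) h :
  const_rank F A x -> vcvg y x -> (\forall k \near ultra, mcone F A (mu k)) ->
  vcvg (fun k => comb (y k) (mu k)) h -> exists2 nu, mcone F A nu & h = comb x nu.
Proof.
move=> /bounded_multipliers[c [c0 hc]] hy hmu hh.
have ci : 0 < c^-1 by rewrite invr_gt0.
(* The value 0 is a placeholder for indices where the hypotheses fail; these indices are negligible
   for [ultra]. *)
have /choice[nu hnu] : forall k, exists nu, vnorm (y k - x) < c^-1 -> mcone F A (mu k) ->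
   [/\ mcone F A nu, comb (y k) nu = comb (y k) (mu k)
    & vnorm nu <= c * vnorm (comb (y k) (mu k))].
  move=> k; have [h1|h1] := pselect (vnorm (y k - x) < c^-1); last by exists 0.
  have [h2|h2] := pselect (mcone F A (mu k)); last by exists 0.
  by have [nu] := hc _ h1 A (subxx _) _ h2; exists nu.
have h1 : vnorm h < vnorm h + 1 by rewrite ltrDl.
have [nu0 hnu0] : exists nu0, vcvg nu nu0.
  apply: (@vcvg_bounded _ _ _ (c * (vnorm h + 1))).
  near=> k; have [||_ _] := hnu k; [by near: k; exact: vcvg_near|by near: k|].
  move=> /le_trans; apply; rewrite ler_wpM2l ?(ltW c0) //.
  by near: k; apply: filterS (cvgr_lt _ (ultra_cvg_vnorm hh) _ h1) => k /ltW.
have ncone : mcone F A nu0.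
  apply: (mcone_cvg hnu0); near=> k.
  by have [||//] := hnu k; [near: k; exact: vcvg_near|near: k].
exists nu0 => //; apply: (vcvg_unique hh).
apply: vcvg_near_eq (vcvg_comb hy hnu0); near=> k.
by have [||//] := hnu k; [near: k; exact: vcvg_near|near: k].
Unshelve. all: by end_near. Qed.

End ConstantRank.

(** * First-order calculus and the penalty method *)

Section Gradients.
Variables (R : realType) (n : nat).
Implicit Types (f : 'cV[R]_n -> R) (g x u : 'cV[R]_n).

Lemma is_gradient_lipschitz f g x : is_gradient f g x -> exists d : R, 0 < d /\
  forall y, vnorm (y - x) < d -> `|f y - f x| <= (vnorm g + 1) * vnorm (y - x).
Proof.
move=> /(_ 1 ltr01)[d [d0 hd]]; exists d; split => // y hy.
have -> : f y - f x = (f y - f x - vdot g (y - x)) + vdot g (y - x) by ring.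
apply: le_trans (ler_normD _ _) _; rewrite mulrDl addrC lerD ?vdot_norm //.
exact: hd.
Qed.

Lemma is_gradient_cvg f g x (y : nat -> 'cV[R]_n) : is_gradient f g x -> vcvg y x ->
  f (y k) @[k --> ultra] --> f x.
Proof.
move=> /is_gradient_lipschitz[d [d0 hd]] hy; apply/cvgrPdist_le => e e0.
have g0 : 0 < vnorm g + 1 by rewrite ltr_wpDl ?vnorm_ge0.
have e1 : 0 < e / (vnorm g + 1) by rewrite divr_gt0.
near=> k; rewrite distrC; apply: le_trans (hd _ _) _.
  by near: k; apply: vcvg_near.
rewrite mulrC -ler_pdivlMr //; apply: ltW; near: k; exact: vcvg_near.
Unshelve. all: by end_near. Qed.

Lemma is_gradient_add f1 f2 g1 g2 x : is_gradient f1 g1 x -> is_gradient f2 g2 x ->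
  is_gradient (fun y => f1 y + f2 y) (g1 + g2) x.
Proof.
move=> h1 h2 e e0; have e2 : 0 < e / 2 by rewrite divr_gt0.
have [d1 [d10 hd1]] := h1 _ e2; have [d2 [d20 hd2]] := h2 _ e2.
exists (Num.min d1 d2); split; first by rewrite lt_min d10.
move=> y; rewrite lt_min => /andP[/hd1 k1 /hd2 k2].
rewrite vdotDl (_ : _ - _ - _ = (f1 y - f1 x - vdot g1 (y - x)) +
  (f2 y - f2 x - vdot g2 (y - x))); last by ring.
apply: le_trans (ler_normD _ _) _; apply: le_trans (lerD k1 k2) _.
by rewrite -mulrDl -splitr.
Qed.

Lemma is_gradient_scale a f g x : is_gradient f g x ->
  is_gradient (fun y => a * f y) (a *: g) x.
Proof.
move=> h e e0; have a0 : 0 < `|a| + 1 by rewrite ltr_wpDl.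
have [d [d0 hd]] := h (e / (`|a| + 1)) ltac:(by rewrite divr_gt0).
exists d; split => // y /hd hy.
rewrite vdotZl -!mulrBr normrM.
apply: le_trans (_ : (`|a| + 1) * (e / (`|a| + 1) * vnorm (y - x)) <= _); last first.
  by rewrite mulrA mulrCA divff ?gt_eqF // mulr1.
by apply: ler_pM => //; rewrite lerDl.
Qed.

Lemma is_gradient_cst a x : is_gradient (fun=> a) 0 x.
Proof.
move=> e e0; exists 1; split => // y _; rewrite subrr vdot0l subr0 normr0.
by rewrite mulr_ge0 ?vnorm_ge0 // ltW.
Qed.

Lemma is_gradient_sum (I : finType) (f : I -> 'cV[R]_n -> R) (g : I -> 'cV[R]_n) x :
  (forall i, is_gradient (f i) (g i) x) ->
  is_gradient (fun y => \sum_i f i y) (\sum_i g i) x.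
Proof.
move=> h; elim: (index_enum I) => [|i r IH].
  rewrite big_nil (_ : (fun _ => _) = fun=> 0); first exact: is_gradient_cst.
  by apply/funext => y; rewrite big_nil.
rewrite big_cons (_ : (fun _ => _) = fun y => f i y + \sum_(j <- r) f j y).
  exact: is_gradient_add.
by apply/funext => y; rewrite big_cons.
Qed.

(** The square splits into its linearisation in [f] and [(f y - f x) ^+ 2], which the local
    Lipschitz bound makes of second order. *)
Lemma is_gradient_sqr f g x s : is_gradient f g x ->
  is_gradient (fun y => (f y - s) ^+ 2) ((2 * (f x - s)) *: g) x.
Proof.
move=> h; have [d1 [d10 hd1]] := is_gradient_lipschitz h.
move=> e e0; have e2 : 0 < e / 2 by rewrite divr_gt0.
have [d2 [d20 hd2]] := is_gradient_scale (2 * (f x - s)) h e2.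
set L := (vnorm g + 1) ^+ 2 + 1.
have L0 : 0 < L by rewrite ltr_wpDl ?sqr_ge0.
exists (Num.min (e / 2 / L) (Num.min d1 d2)); split.
  by rewrite !lt_min d10 d20 divr_gt0.
move=> y; rewrite !lt_min => /andP[k0 /andP[/hd1 k1 /hd2 k2]].
rewrite (_ : _ - _ - _ = (2 * (f x - s) * f y - 2 * (f x - s) * f x -
  vdot ((2 * (f x - s)) *: g) (y - x)) + (f y - f x) ^+ 2); last by ring.
have -> : e * vnorm (y - x) = e / 2 * vnorm (y - x) + e / 2 * vnorm (y - x).
  by rewrite -mulrDl -splitr.
apply: le_trans (ler_normD _ _) _; apply: lerD => //.
rewrite normrX; apply: le_trans (_ : ((vnorm g + 1) * vnorm (y - x)) ^+ 2 <= _).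
  by rewrite ler_pXn2r ?nnegrE // mulr_ge0 ?vnorm_ge0 // addr_ge0 ?vnorm_ge0.
rewrite exprMn expr2 [in X in _ * X]expr2 mulrA ler_wpM2r ?vnorm_ge0 //.
move: k0; rewrite ltr_pdivlMr // mulrC => /ltW; apply: le_trans.
by rewrite ler_wpM2r ?vnorm_ge0 // /L expr2 lerDl.
Qed.

Lemma is_gradient_vnorm_sqr u x :
  is_gradient (fun y => vnorm (y - u) ^+ 2) (2 *: (x - u)) x.
Proof.
move=> e e0; exists e; split => // y hy.
rewrite !vnorm_sqr (_ : _ - _ - _ = vnorm (y - x) ^+ 2).
  by rewrite normrX (ger0_norm (vnorm_ge0 _)) expr2 ler_wpM2r ?vnorm_ge0 // ltW.
rewrite vnorm_sqr !(vdotBl, vdotBr, vdotZl) (vdotC x y) (vdotC u y) (vdotC u x).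
ring.
Qed.

Lemma gradient_min0 f g x : is_gradient f g x -> (forall y, f x <= f y) -> g = 0.
Proof.
move=> h hmin; apply: vnorm_eq0; apply/eqP; apply: contraT => g0.
have gp : 0 < vnorm g by rewrite lt_neqAle eq_sym g0 vnorm_ge0.
have [d [d0 hd]] := h (vnorm g / 2) ltac:(by rewrite divr_gt0).
(* The trial step along [- g] has length [d / 2]; the first-order decrease [t * vnorm g ^+ 2]
   exceeds twofold what the remainder can offset. *)
pose t := d / (2 * vnorm g).
have t0 : 0 < t by rewrite divr_gt0 // mulr_gt0.
have ey : x - t *: g - x = - (t *: g) by rewrite addrAC subrr add0r.
have ny : vnorm (- (t *: g)) = t * vnorm g by rewrite vnormN vnormZ gtr0_norm.
have td : t * vnorm g < d.
  rewrite /t -mulrA invfM -mulrA mulVf ?mulr1 ?gt_eqF //.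
  by rewrite ltr_pdivrMr // ltr_pMr // ltr1n.
have := hd (x - t *: g); rewrite ey ny => /(_ td).
rewrite vdotNr vdotZr -vnorm_sqr => /(le_trans (ler_norm _)).
have := hmin (x - t *: g).
have : 0 < t * vnorm g ^+ 2 by rewrite mulr_gt0 // exprn_gt0.
by rewrite !expr2; nra.
Qed.

Lemma is_derive_line f (g : 'cV[R]_n -> 'cV[R]_n) x u t :
  is_gradient f (g (x + t *: u)) (x + t *: u) ->
  is_derive t 1 (fun s : R => f (x + s *: u)) (vdot (g (x + t *: u)) u).
Proof.
move=> hf; set l := vdot _ u; set phi := fun s : R => _.
have hc : h^-1 *: (phi (h *: 1 + t) - phi t) @[h --> (0 : R)^'] --> l.
  apply/cvgrPdist_le => e e0.
  have u0 : 0 < vnorm u + 1 by rewrite ltr_wpDl ?vnorm_ge0.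
  have [d [d0 hd]] := hf (e / (vnorm u + 1)) ltac:(by rewrite divr_gt0).
  have du : 0 < d / (vnorm u + 1) by rewrite divr_gt0.
  near=> h.
  have h0 : h != 0 by near: h; exact: nbhs_dnbhs_neq.
  have hp : 0 < `|h| by rewrite normr_gt0.
  have hs : x + (h *: 1 + t) *: u - (x + t *: u) = h *: u.
    by rewrite [h *: 1]mulr1 scalerDl opprD addrACA subrr add0r addrK.
  have hdl : vnorm (x + (h *: 1 + t) *: u - (x + t *: u)) < d.
    rewrite hs vnormZ; apply: le_lt_trans (_ : `|h| * (vnorm u + 1) < _).
      by rewrite ler_wpM2l // lerDl.
    by rewrite -ltr_pdivlMr //; near: h; exact: dnbhs0_lt.
  have := hd _ hdl; rewrite hs vdotZr vnormZ -/l => H.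
  rewrite distrC -(@ler_pM2l _ `|h|) // -normrM.
  have -> : h * (h^-1 *: (phi (h *: 1 + t) - phi t) - l) =
     phi (h *: 1 + t) - phi t - h * l.
    by rewrite mulrBr; congr (_ - _); rewrite [_ *: _]/(_ * _) mulrA divff // mul1r.
  apply: le_trans H _; rewrite mulrC -mulrA ler_wpM2l // mulrCA.
  by rewrite ger_pMr // ler_pdivrMr // mul1r lerDl.
split; first by apply/cvg_ex; exists l.
exact: cvg_lim hc.
Unshelve. all: by end_near. Qed.

Lemma mean_value f (g : 'cV[R]_n -> 'cV[R]_n) x u :
  (forall y, is_gradient f (g y) y) ->
  exists2 s : R, 0 <= s <= 1 & f (x + u) - f x = vdot (g (x + s *: u)) u.
Proof.
move=> hf; pose phi s := f (x + s *: u).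
have hd (t : R) : is_derive t 1 phi (vdot (g (x + t *: u)) u) by exact: is_derive_line.
have cphi : {within `[0, 1], continuous phi}.
  by apply: derivable_within_continuous => t _; have [] := hd t.
have [c] := @MVT_segment R phi _ 0 1 ler01 (fun t _ => hd t) cphi.
rewrite in_itv /= => hc; rewrite subr0 mulr1 /phi scale1r scale0r addr0 => e.
by exists c.
Qed.

(** The estimate is uniform in the base point [y], as needed when that point is a projection not
    known in advance. It comes from the mean value theorem and continuity of the gradient at [x]. *)
Lemma strict_gradient f (g : 'cV[R]_n -> 'cV[R]_n) x :
  (forall y, is_gradient f (g y) y) -> vcontinuous g x ->
  forall e, 0 < e -> exists d : R, 0 < d /\ forall u y, vnorm (u - x) < d ->
    vnorm (y - x) < d -> `|f u - f y - vdot (g y) (u - y)| <= e * vnorm (u - y).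
Proof.
move=> hf hg e e0; have [d [d0 hd]] := hg (e / 2) ltac:(by rewrite divr_gt0).
exists d; split => // u y hu hy.
have [s /andP[s0 s1]] := mean_value y (u - y) hf; rewrite [y + (u - y)]addrC subrK => ->.
rewrite -vdotBl; apply: le_trans (vdot_norm _ _) _; rewrite ler_wpM2r ?vnorm_ge0 //.
apply: le_trans (vnorm_triangle (g x) _ _) _; rewrite [leRHS]splitr lerD //.
  apply: hd.
  have -> : y + s *: (u - y) - x = (1 - s) *: (y - x) + s *: (u - x).
    by apply/colP => i; rewrite !mxE; ring.
  apply: le_lt_trans (vnormD _ _) _; rewrite !vnormZ !ger0_norm ?subr_ge0 //.
  have [->|sn1] := eqVneq s 1; first by rewrite subrr mul0r add0r mul1r.
  have s1' : 0 < 1 - s by rewrite subr_gt0 lt_neqAle sn1.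
  nra.
by rewrite vnormC; apply: hd.
Qed.

Lemma jacobian_continuous (G : 'cV[R]_n -> 'cV[R]_n) (H : 'M[R]_n) x :
  is_jacobian G H x -> vcontinuous G x.
Proof.
move=> hG; pose L := \sum_i vnorm (row i H)^T.
have L0 : 0 <= L by apply: sumr_ge0 => i _; exact: vnorm_ge0.
have hL w : vnorm (H *m w) <= L * vnorm w.
  apply: le_trans (vnorm_le_sum _) _; rewrite mulr_suml; apply: ler_sum => i _.
  apply: le_trans (vdot_norm (row i H)^T w); rewrite le_eqVlt; apply/orP; left.
  by rewrite mxE; apply/eqP; congr `|_|; apply: eq_bigr => j _; rewrite !mxE.
move=> e e0; have [d [d0 hd]] := hG 1 ltr01.
have L1 : 0 < 1 + L by rewrite ltr_pwDl.
exists (Num.min d (e / (1 + L))); split; first by rewrite lt_min d0 divr_gt0.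
move=> y; rewrite lt_min => /andP[/hd h1 h2].
rewrite -[G y - G x](subrK (H *m (y - x))); apply: le_trans (vnormD _ _) _.
apply: le_trans (lerD h1 (hL _)) _; rewrite -mulrDl mulrC -ler_pdivlMr //.
exact: ltW.
Qed.

End Gradients.

(** * Projection onto the feasible set by quadratic penalties *)

Section Penalty.
Variables (R : realType) (n m : nat).
Variables (q : 'I_m -> 'cV[R]_n -> R) (g : 'I_m -> 'cV[R]_n -> 'cV[R]_n).
Hypothesis q_grad : forall i x, is_gradient (q i) (g i x) x.
Hypothesis g_cont : forall i x, vcontinuous (g i) x.
Implicit Types (F A B : {set 'I_m}) (x y z u : 'cV[R]_n).

Definition feas F A y :=
  (forall i, i \in F -> q i y = 0) /\ (forall i, i \in A -> q i y <= 0).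

(** A minimising sequence in the ball is bounded, so it converges along [ultra], and its limit
    attains the infimum. *)
Lemma ball_minimum (f : 'cV[R]_n -> R) u (r : R) : 0 <= r ->
  (forall y, 0 <= f y) ->
  (forall (y : nat -> 'cV[R]_n) x, vcvg y x -> f (y k) @[k --> ultra] --> f x) ->
  exists2 y, vnorm (y - u) <= r & forall z, vnorm (z - u) <= r -> f y <= f z.
Proof.
move=> r0 f0 fc; pose E := [set f y | y in [set y | vnorm (y - u) <= r]].
have E0 : has_inf E.
  split; first by exists (f u), u => //=; rewrite subrr vnorm0.
  by exists 0 => _ [y _ <-].
have /choice[y hy] : forall k : nat, exists y, vnorm (y - u) <= r /\
    f y < inf E + k.+1%:R^-1.
  move=> k; have k0 : 0 < k.+1%:R^-1 :> R by rewrite invr_gt0 ltr0n.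
  by have [_ [y yr <-] h] := inf_adherent k0 E0; exists y.
have [x hx] : exists x, vcvg y x.
  apply: (@vcvg_bounded _ _ _ (r + vnorm u)); apply: nearW => k.
  rewrite -[y k](subrK u); apply: le_trans (vnormD _ _) _.
  by rewrite lerD2r; have [] := hy k.
exists x.
  have h := ultra_cvg_vnorm (vcvgB hx (@vcvg_cst R n u)).
  by apply: (cvgr_to_le h); apply: nearW => k; have [] := hy k.
move=> z hz; apply: le_trans (_ : inf E <= _); last first.
  by apply: ge_inf; [case: E0 | exists z].
have hE : (inf E + k.+1%:R^-1 : R) @[k --> ultra] --> inf E + 0.
  by apply: cvgD; [exact: cvg_cst | exact: harmonic_ultra].
rewrite -[leRHS]addr0; apply: (ler_cvg_to (fc _ _ hx) hE).
by apply: nearW => k; apply: ltW; have [] := hy k.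
Qed.

Let viol F A (i : 'I_m) (a : R) : R :=
  if i \in F then a else if i \in A then (a + `|a|) / 2 else 0.

Let viol_cvg F A i (a : nat -> R) b : a k @[k --> ultra] --> b ->
  viol F A i (a k) @[k --> ultra] --> viol F A i b.
Proof.
move=> ha; rewrite /viol; case: ifP => // _; case: ifP => _; last exact: cvg_cst.
apply: cvgM; last exact: cvg_cst.
by apply: cvgD => //; apply: cvg_norm.
Qed.

(** The first-order condition at a minimiser of the penalised squared distance gives the
    multipliers; comparing with the value at the feasible [z] bounds the violation. *)
Lemma penalty_minimizer F A z u (k : R) : 0 < k -> feas F A z ->
  exists y, [/\ vnorm (y - u) <= vnorm (z - u),
    u - y = comb g y (\col_i (k * viol F A i (q i y)))
    & forall i, k * viol F A i (q i y) ^+ 2 <= vnorm (z - u) ^+ 2].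
Proof.
move=> k0 [zF zA].
pose P y := \sum_i viol F A i (q i y) ^+ 2.
have P0 y : 0 <= P y by apply: sumr_ge0 => i _; exact: sqr_ge0.
pose phi y := vnorm (y - u) ^+ 2 + k * P y.
have Pz : P z = 0.
  apply: big1 => i _; rewrite /viol; case: ifP => [/zF ->|_]; first by rewrite expr0n.
  case: ifP => [/zA h|_]; last by rewrite expr0n.
  by rewrite ler0_norm // subrr mul0r expr0n.
have [|||y yz ymin] := @ball_minimum phi u (vnorm (z - u)).
- exact: vnorm_ge0.
- by move=> y; rewrite addr_ge0 ?sqr_ge0 // mulr_ge0 // ltW.
- move=> y x hy; apply: cvgD.
    by do 2?apply: cvgM; apply: ultra_cvg_vnorm; apply: vcvgB => //; exact: vcvg_cst.
  apply: cvgM; first exact: cvg_cst.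
  apply: ultra_cvg_sum => i.
  by do 2?apply: cvgM; apply: viol_cvg; apply: is_gradient_cvg hy.
have phiy : phi y <= vnorm (z - u) ^+ 2.
  by have := ymin z (lexx _); rewrite {2}/phi Pz mulr0 addr0.
(* Outside the ball the distance term alone exceeds the value at [z], so the minimum over the ball
   is global. *)
have yglob w : phi y <= phi w.
  have [h|h] := leP (vnorm (w - u)) (vnorm (z - u)); first exact: ymin.
  apply: le_trans phiy _; apply: le_trans (_ : vnorm (w - u) ^+ 2 <= _).
    by rewrite ler_pXn2r ?nnegrE ?vnorm_ge0 // ltW.
  by rewrite lerDl mulr_ge0 // ltW.
exists y; split => //; last first.
  move=> i; apply: le_trans phiy; apply: le_trans (_ : k * P y <= _).
    rewrite ler_wpM2l ?(ltW k0) // /P (bigD1 i) //= lerDl.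
    by apply: sumr_ge0 => j _; exact: sqr_ge0.
  by rewrite lerDr sqr_ge0.
(* (q - s)^2 is a smooth majorant of the penalty term, exact at y. *)
pose s i := q i y - viol F A i (q i y).
pose psi w := vnorm (w - u) ^+ 2 + k * \sum_i (q i w - s i) ^+ 2.
have psimin w : psi y <= psi w.
  have -> : psi y = phi y.
    rewrite /psi /phi /P; congr (_ + _ * _); apply: eq_bigr => i _.
    by rewrite /s opprB addrC subrK.
  apply: le_trans (yglob w) _; rewrite lerD2l ler_wpM2l ?(ltW k0) //.
  apply: ler_sum => i _; rewrite /s /viol.
  case: ifP => [_|iF]; first by rewrite subrr subr0.
  case: ifP => [_|iA]; last by rewrite expr0n sqr_ge0.
  have hb : (q i w + `|q i w|) / 2 = Num.max (q i w) 0.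
    have [b0|b0] := leP (q i w) 0; first by rewrite ler0_norm // subrr mul0r.
    by rewrite gtr0_norm //; lra.
  have ha : q i y - (q i y + `|q i y|) / 2 <= 0.
    by have := ler_norm (q i y); lra.
  have [b0|b0] := leP (q i w) 0; first by rewrite hb max_r // expr0n sqr_ge0.
  by rewrite hb max_l ?(ltW b0) // ler_pXn2r ?nnegrE //; lra.
have hg := is_gradient_add (is_gradient_vnorm_sqr u y)
  (is_gradient_scale k (is_gradient_sum (fun i => is_gradient_sqr (s i) (q_grad i y)))).
have := gradient_min0 hg psimin.
have -> : k *: \sum_i (2 * (q i y - s i)) *: g i y =
    2 *: comb g y (\col_i (k * viol F A i (q i y))).
  rewrite /comb !scaler_sumr; apply: eq_bigr => i _; rewrite !scalerA mxE.
  by rewrite /s opprB addrCA subrr addr0 mulrCA.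
move=> /eqP; rewrite -scalerDr scaler_eq0 pnatr_eq0 /= addr_eq0 => /eqP.
by rewrite -[u - y]opprB => ->; rewrite opprK.
Qed.

(** As the penalty grows, minimisers tend to a feasible [p]; rewriting their multipliers with
    [bounded_multipliers] keeps them bounded, so they converge as well. *)
Lemma penalty_projection F A z : const_rank g F A z -> feas F A z ->
  exists c : R, 0 < c /\ forall u, vnorm (u - z) < c^-1 ->
    exists p lam, [/\ feas F A p, mcone F A lam, forall i, lam i 0 * q i p = 0,
      u - p = comb g p lam
      & vnorm lam <= c * vnorm (u - p) /\ vnorm (u - p) <= vnorm (u - z)].
Proof.
move=> /(bounded_multipliers g_cont)[c [c0 hc]] zf.
(* The factor 2 is needed because [y k] may be twice as far from [z] as [u] is, yet must stay within
   [c^-1]. *)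
exists (2 * c); split; first by rewrite mulr_gt0.
move=> u hu.
have /choice[y hy] := fun k : nat => penalty_minimizer u (ltr0Sn R k) zf.
have [p hp] : exists p, vcvg y p.
  apply: (@vcvg_bounded _ _ _ (vnorm (z - u) + vnorm u)); apply: nearW => k.
  rewrite -[y k](subrK u); apply: le_trans (vnormD _ _) _.
  by rewrite lerD2r; have [] := hy k.
have yz k : vnorm (y k - z) < c^-1.
  apply: le_lt_trans (vnorm_triangle u _ _) _.
  have [h _ _] := hy k; apply: le_lt_trans (lerD h (lexx _)) _.
  by move: hu; rewrite (vnormC z) invfM; lra.
have violp i : viol F A i (q i p) = 0.
  have h1 : viol F A i (q i (y k)) @[k --> ultra] --> viol F A i (q i p).
    by apply: viol_cvg; apply: is_gradient_cvg hp.
  have h2 : (k.+1%:R^-1 * vnorm (z - u) ^+ 2 : R) @[k --> ultra] --> 0 * vnorm (z - u) ^+ 2.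
    by apply: cvgM; [exact: harmonic_ultra | exact: cvg_cst].
  have : viol F A i (q i p) * viol F A i (q i p) <= 0.
    rewrite -[leRHS](mul0r (vnorm (z - u) ^+ 2)).
    apply: (ler_cvg_to (cvgM h1 h1) h2); apply: nearW => k.
    have [_ _ /(_ i)] := hy k.
    by rewrite mulrC -ler_pdivlMr ?ltr0n // mulrC.
  move=> h; apply/eqP; rewrite -sqrf_eq0 expr2 eq_le h /= -expr2.
  exact: sqr_ge0.
have pf : feas F A p.
  split=> i iF; first by have := violp i; rewrite /viol iF.
  have := violp i; rewrite /viol iF; case: ifP => [_ -> //|_].
  by have := normr_ge0 (q i p); lra.
(* Inequalities slack at [p] are slack at [y k] too, so only constraints tight at [p] keep
   multipliers; this yields complementarity. *)
pose B := [set i in A | q i p == 0]%SET.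
have sBA : B \subset A by apply/fintype.subsetP => i; rewrite inE => /andP[].
pose mu k : 'cV[R]_m := \col_i (k.+1%:R * viol F A i (q i (y k))).
have muB : \forall k \near ultra, mcone F B (mu k).
  have h : \forall k \near ultra, forall i, i \notin F :|: B -> mu k i 0 = 0.
    apply: filter_forall => i; have [|iFB] := boolP (i \in F :|: B).
      by move=> _; apply: nearW.
    move: (iFB); rewrite !inE negb_or negb_and => /andP[/negbTE iF iAq].
    have [iA|iA] := boolP (i \in A); last first.
      by apply: nearW => k _; rewrite mxE /viol iF (negbTE iA) mulr0.
    have qp0 : q i p < 0 by rewrite lt_neqAle pf.2 // andbT; move: iAq; rewrite iA.
    apply: filterS (cvgr_lt _ (is_gradient_cvg (q_grad i p) hp) _ qp0) => k qk _.
    by rewrite mxE /viol iF iA ltr0_norm // subrr mul0r mulr0.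
  apply: filterS h => k h; split => // i iF; rewrite mxE mulr_ge0 // /viol (negbTE iF).
  case: ifP => // _; rewrite divr_ge0 //.
  by have := ler_norm (- q i (y k)); rewrite normrN; lra.
have /choice[nu hnu] : forall k, exists nu, mcone F B (mu k) ->
   [/\ mcone F B nu, comb g (y k) nu = u - y k & vnorm nu <= c * vnorm (u - y k)].
  move=> k; have [h|h] := pselect (mcone F B (mu k)); last by exists 0.
  have [nu] := hc _ (yz k) B sBA _ h; have [_ -> _] := hy k.
  by exists nu.
have [lam hlam] : exists lam, vcvg nu lam.
  apply: (@vcvg_bounded _ _ _ (c * vnorm (z - u))).
  near=> k; have [|_ _] := hnu k; first by near: k.
  move=> /le_trans; apply; rewrite ler_wpM2l ?(ltW c0) // vnormC.
  by have [] := hy k.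
have lB : mcone F B lam.
  by apply: (mcone_cvg hlam); near=> k; have [|//] := hnu k; near: k.
have huy : vcvg (fun k => u - y k) (u - p) by apply: vcvgB => //; exact: vcvg_cst.
exists p, lam; split => //.
- have [l1 l2] := lB; split => // i; rewrite inE negb_or => /andP[iF iA].
  by apply: l1; rewrite !inE negb_or iF (negbTE iA).
- move=> i; have [l1 l2] := lB; have [|/l1 ->] := boolP (i \in F :|: B); last by rewrite mul0r.
  rewrite !inE => /orP[/pf.1 ->|/andP[_ /eqP ->]]; by rewrite mulr0.
- apply: (vcvg_unique huy); apply: vcvg_near_eq (vcvg_comb g_cont hp hlam).
  by near=> k; have [|//] := hnu k; near: k.
- have hn := ultra_cvg_vnorm huy; split.
    apply: le_trans (_ : c * vnorm (u - p) <= _); last first.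
      by rewrite ler_wpM2r ?vnorm_ge0 //; lra.
    have hcn : (c * vnorm (u - y k)) @[k --> ultra] --> c * vnorm (u - p).
      by apply: cvgM => //; exact: cvg_cst.
    apply: (ler_cvg_to (ultra_cvg_vnorm hlam) hcn).
    by near=> k; have [|//] := hnu k; near: k.
  rewrite [leRHS]vnormC; apply: (cvgr_to_le hn); apply: nearW => k.
  by rewrite vnormC; have [] := hy k.
Unshelve. all: by end_near. Qed.

End Penalty.

(** * Error bound, tangent cones and normal cones *)

Lemma fin_radius (R : realType) (I : finType) (P : I -> R -> Prop) :
  (forall i d e, e <= d -> P i d -> P i e) ->
  (forall i, exists d, 0 < d /\ P i d) -> exists d, 0 < d /\ forall i, P i d.
Proof.
move=> Pm /choice[d hd]; exists (\big[Num.min/1]_i d i); split.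
  elim/big_ind: _ => // [a b a0 b0|i _]; first by rewrite lt_min a0.
  exact: (hd i).1.
by move=> i; apply: Pm (hd i).2; rewrite (bigD1 i) //= ge_min lexx.
Qed.

(** * Tangent directions and difference quotients along the ultrafilter *)

Section UltraTangents.
Variables (R : realType) (n : nat).
Implicit Types (x w z : 'cV[R]_n) (t : nat -> R) (u v : nat -> 'cV[R]_n).

Lemma tcone2_ultra (S : set ('cV[R]_n * 'cV[R]_n)) x y w z t u v :
  (forall k, 0 < t k) -> t k @[k --> ultra] --> 0 -> vcvg u w -> vcvg v z ->
  (\forall k \near ultra, S (x + t k *: u k, y + t k *: v k)) ->
  tcone2 S (x, y) (w, z).
Proof.
move=> t0 tc uw vz hS.
have /choice[f hf] : forall j : nat, exists k, [/\ t k < j.+1%:R^-1,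
    vnorm (u k - w) < j.+1%:R^-1, vnorm (v k - z) < j.+1%:R^-1
    & S (x + t k *: u k, y + t k *: v k)].
  move=> j; have j0 : 0 < j.+1%:R^-1 :> R by rewrite invr_gt0 ltr0n.
  near ultra => k; exists k; split; near: k => //; try exact: vcvg_near.
  exact: (cvgr_lt _ tc _ j0).
have hN (e : R) : 0 < e -> exists N : nat, forall k, (N <= k)%N -> k.+1%:R^-1 < e.
  move=> e0; have [N _ hN] := cvgr_lt _ (@cvg_harmonic R) _ e0.
  by exists N => k Nk; apply: hN.
exists (t \o f), (u \o f), (v \o f); split => [k||||k] /=; first exact: t0.
- move=> e /hN[N h]; exists N => k /h hk; rewrite gtr0_norm ?t0 //=.
  by apply: lt_trans hk; have [] := hf k.
- by move=> e /hN[N h]; exists N => k /h hk; apply: lt_trans hk; have [] := hf k.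
- by move=> e /hN[N h]; exists N => k /h hk; apply: lt_trans hk; have [] := hf k.
- by have [] := hf k.
Unshelve. all: by end_near. Qed.

Lemma tcone_ultra (S : set 'cV[R]_n) x w t u :
  (forall k, 0 < t k) -> t k @[k --> ultra] --> 0 -> vcvg u w ->
  (\forall k \near ultra, S (x + t k *: u k)) -> tcone S x w.
Proof.
move=> t0 tc uw hS.
have [|s [a [b [h1 h2 h3 _ h5]]]] :=
  @tcone2_ultra [set p | S p.1] x 0 w 0 t u (fun=> 0) t0 tc uw (@vcvg_cst _ _ 0).
  exact: hS.
by exists s, a.
Qed.

Lemma vcvg_line x w t u : t k @[k --> ultra] --> 0 -> vcvg u w ->
  vcvg (fun k => x + t k *: u k) x.
Proof.
move=> tc uw; rewrite -[X in vcvg _ X]addr0 -(scale0r w).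
by apply: vcvgD; [exact: vcvg_cst | exact: vcvgZ].
Qed.

(* [rem] stands for the Taylor remainder of a function at [x]. *)
Lemma remainder_cvg (p : nat) (rem : 'cV[R]_n -> 'cV[R]_p) x w t u :
  (forall e, 0 < e -> exists d : R, 0 < d /\ forall y, vnorm (y - x) < d ->
    vnorm (rem y) <= e * vnorm (y - x)) ->
  (forall k, 0 < t k) -> t k @[k --> ultra] --> 0 -> vcvg u w ->
  vcvg (fun k => (t k)^-1 *: rem (x + t k *: u k)) 0.
Proof.
move=> hrem t0 tc uw; apply: vcvg_eps => e e0.
have w1 : 0 < vnorm w + 1 by rewrite ltr_wpDl ?vnorm_ge0.
have [d [d0 hd]] := hrem (e / (vnorm w + 1)) ltac:(by rewrite divr_gt0).
have wl : vnorm w < vnorm w + 1 by rewrite ltrDl.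
near=> k; rewrite subr0 vnormZ gtr0_norm ?invr_gt0 // mulrC ler_pdivrMr //.
apply: le_trans (hd _ _) _; first by near: k; apply: vcvg_near d0; exact: vcvg_line tc uw.
rewrite addrAC subrr add0r vnormZ gtr0_norm // mulrCA mulrC ler_wpM2r ?(ltW (t0 k)) //.
rewrite mulrAC ler_pdivrMr // ler_wpM2l ?(ltW e0) //; apply: ltW.
by near: k; exact: (cvgr_lt _ (ultra_cvg_vnorm uw) _ wl).
Unshelve. all: by end_near. Qed.

Lemma gradient_quotient_cvg (f : 'cV[R]_n -> R) (g : 'cV[R]_n) x w t u :
  is_gradient f g x ->
  (forall k, 0 < t k) -> t k @[k --> ultra] --> 0 -> vcvg u w ->
  (t k)^-1 * (f (x + t k *: u k) - f x) @[k --> ultra] --> vdot g w.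
Proof.
move=> hf t0 tc uw.
(* The scalar remainder is viewed as a vector of length 1, so that [remainder_cvg] applies. *)
have h : vcvg (fun k => (t k)^-1 *: (\col_(_ < 1)
    (f (x + t k *: u k) - f x - vdot g (x + t k *: u k - x)))) 0.
  apply: (@remainder_cvg 1 (fun y => \col_(_ < 1) (f y - f x - vdot g (y - x)))
    x w t u) => // e e0; have [d [d0 hd]] := hf e e0.
  exists d; split => // y /hd; congr (_ <= _); rewrite /vnorm /vdot big_ord1 !mxE.
  by rewrite -expr2 sqrtr_sqr.
have h1 : ((t k)^-1 *: (\col_(_ < 1)
    (f (x + t k *: u k) - f x - vdot g (x + t k *: u k - x)))) 0 0 + vdot g (u k)
    @[k --> ultra] --> (0 : 'cV[R]_1) 0 0 + vdot g w.
  apply: cvgD; first exact: h.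
  by apply: (ultra_cvg_vdot (u := fun=> g)) => //; exact: vcvg_cst.
rewrite [X in _ --> X + _]mxE add0r in h1; apply: ultra_cvg_near_eq h1.
apply: nearW => k /=; rewrite !mxE [x + _]addrC addrK vdotZr.
by rewrite mulrBr mulrA mulVf ?gt_eqF // mul1r subrK.
Qed.

Lemma jacobian_quotient_cvg (G : 'cV[R]_n -> 'cV[R]_n) (H : 'M[R]_n) x w t u :
  is_jacobian G H x ->
  (forall k, 0 < t k) -> t k @[k --> ultra] --> 0 -> vcvg u w ->
  vcvg (fun k => (t k)^-1 *: (G (x + t k *: u k) - G x)) (H *m w).
Proof.
move=> hG t0 tc uw; have h := remainder_cvg hG t0 tc uw.
have hH : vcvg (fun k => H *m u k) (H *m w).
  move=> i; rewrite mxE; under eq_fun do rewrite mxE.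
  by apply: ultra_cvg_sum => j; apply: cvgM; [exact: cvg_cst | exact: uw].
have := vcvgD h hH; rewrite add0r; apply: vcvg_near_eq; apply: nearW => k.
rewrite scalerBr [x + _]addrC addrK -scalemxAr scalerA mulVf ?gt_eqF //.
by rewrite scale1r subrK.
Qed.

End UltraTangents.

(** * Error bound and feasible paths with a prescribed direction *)

Section FeasibleSets.
Variables (R : realType) (n m : nat).
Variables (q : 'I_m -> 'cV[R]_n -> R) (g : 'I_m -> 'cV[R]_n -> 'cV[R]_n).
Hypothesis q_grad : forall i x, is_gradient (q i) (g i x) x.
Hypothesis g_cont : forall i x, vcontinuous (g i) x.
Implicit Types (F A B : {set 'I_m}) (x y z u w : 'cV[R]_n).

Definition act A x : {set 'I_m} := [set i in A | q i x == 0]%SET.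

Definition lin F A x w :=
  (forall i, i \in F -> vdot (g i x) w = 0) /\
  (forall i, i \in A -> vdot (g i x) w <= 0).

(** With [D] the norm of [u - p], pairing [u - p] with its own multiplier representation and
    linearising each [q i] bounds [D ^+ 2] by [c * D * N] plus half of [D ^+ 2]: complementarity
    removes [q i p], and the signs of [lam] and [y] allow subtracting [y]. *)
Lemma error_bound F A z : const_rank g F A z -> feas q F A z ->
  exists c : R, 0 < c /\ forall u, vnorm (u - z) < c^-1 ->
    exists p, [/\ feas q F A p, vnorm (u - p) <= vnorm (u - z)
      & forall y : 'cV[R]_m, (forall i, i \in F -> y i 0 = 0) ->
          (forall i, i \in A -> y i 0 <= 0) ->
          vnorm (u - p) <= c * vnorm (\col_i q i u - y)].
Proof.
move=> hr hz; have [c [c0 hc]] := penalty_projection q_grad g_cont hr hz.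
(* With this [e], linearisation errors weighted by multipliers of norm at most [c * D] sum to at
   most half of [D ^+ 2]. *)
pose e : R := (2 * (m%:R * c) + 1)^-1.
have mc : 0 <= m%:R * c by rewrite mulr_ge0 // ltW.
have e0 : 0 < e by rewrite invr_gt0; lra.
have e1 : m%:R * c * e <= 2^-1.
  by rewrite /e ler_pdivrMr; lra.
have [d [d0 hd]] := fin_radius (I := 'I_m)
  (P := fun i d => forall u y, vnorm (u - z) < d -> vnorm (y - z) < d ->
     `|q i u - q i y - vdot (g i y) (u - y)| <= e * vnorm (u - y))
  (fun i d' e' le h u y hu hy => h u y (lt_le_trans hu le) (lt_le_trans hy le))
  (fun i => strict_gradient (q_grad i) (g_cont i z) e0).
(* [2 / d] keeps [u] within [d / 2] of [z], hence [p] within [d]; the 2 in [2 * c] compensates for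
   the absorbed half of [D ^+ 2]. *)
have c2 : 0 < 2 * c + 2 / d by apply: addr_gt0; [exact: mulr_gt0 | exact: divr_gt0].
exists (2 * c + 2 / d); split => // u hu.
have uc : vnorm (u - z) < c^-1.
  apply: lt_le_trans hu _; rewrite lef_pV2 ?posrE //.
  have : 0 < 2 / d by rewrite divr_gt0.
  lra.
have ud : 2 * vnorm (u - z) < d.
  rewrite mulrC -ltr_pdivlMr //; apply: lt_le_trans hu _.
  have d2 : 0 < 2 / d by rewrite divr_gt0.
  rewrite -[leRHS]invf_div lef_pV2 ?posrE //; lra.
have [p [lam [pf [lams lamp] lamq up [lamn pz]]]] := hc u uc.
exists p; split => // y yF yA.
have pd : vnorm (p - z) < d.
  apply: le_lt_trans (vnorm_triangle u _ _) _; rewrite (vnormC p).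
  by apply: le_lt_trans (lerD pz (lexx _)) _; lra.
have ud' : vnorm (u - z) < d by have := vnorm_ge0 (u - z); lra.
set D := vnorm (u - p) in lamn pz *; set N := vnorm (_ - y).
have D0 : 0 <= D by exact: vnorm_ge0.
have N0 : 0 <= N by exact: vnorm_ge0.
have hD : D ^+ 2 <= vdot lam (\col_i q i u - y) + \sum_i `|lam i 0| * (e * D).
  rewrite vnorm_sqr {1}up vdot_comb -big_split; apply: ler_sum => i _ /=.
  rewrite !mxE; have := hd i u p ud' pd; rewrite -/D => H.
  have h1 : lam i 0 * y i 0 <= 0.
    have [iF|iF] := boolP (i \in F); first by rewrite yF // mulr0.
    have [iA|iA] := boolP (i \in A); first by rewrite mulr_ge0_le0 ?lamp ?yA.
    by rewrite lams ?mul0r // inE negb_or iF.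
  have h2 : - (lam i 0 * (q i u - q i p - vdot (g i p) (u - p))) <=
      `|lam i 0| * (e * D).
    apply: le_trans (ler_norm _) _; rewrite normrN normrM ler_wpM2l //.
  have := lamq i; move: h1 h2; rewrite !mulrBr; lra.
have h1 : vdot lam (\col_i q i u - y) <= c * D * N.
  by apply: le_trans (vdot_le _ _) _; rewrite ler_wpM2r.
have h2 : \sum_i `|lam i 0| * (e * D) <= 2^-1 * D * D.
  rewrite -mulr_suml; apply: le_trans (_ : m%:R * (c * D) * (e * D) <= _).
    rewrite ler_wpM2r ?mulr_ge0 ?(ltW e0) //; apply: le_trans (sum_le_vnorm _) _.
    by rewrite ler_wpM2l.
  rewrite (_ : _ * _ * _ = m%:R * c * e * D * D); last by ring.
  by rewrite ler_wpM2r // ler_wpM2r.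
have [D00|Dn0] := eqVneq D 0; first by rewrite D00 mulr_ge0 // ltW.
have Dp : 0 < D by rewrite lt_neqAle eq_sym Dn0.
apply: le_trans (_ : 2 * c * N <= _); last first.
  by rewrite ler_wpM2r // lerDl divr_ge0 // ltW.
rewrite -(@ler_pM2l _ D) //; move: hD; rewrite expr2; lra.
Qed.

(** Since [w] solves the linearised system, [x + t k *: w] violates the constraints by o(t), and the
    error bound supplies feasible points at distance o(t). *)
Lemma tangent_path F A x w (t : nat -> R) : const_rank g F A x ->
  (forall i, i \in F :|: A -> q i x = 0) -> lin F A x w ->
  (forall k, 0 < t k) -> t k @[k --> ultra] --> 0 ->
  exists2 u, vcvg u w & \forall k \near ultra, feas q F A (x + t k *: u k).
Proof.
move=> hr hq [wF wA] t0 tc.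
have xf : feas q F A x.
  by split=> i iF; rewrite hq // inE iF ?orbT.
have [c [c0 hc]] := error_bound hr xf.
have ci : 0 < c^-1 by rewrite invr_gt0.
have near_c : \forall k \near ultra, vnorm (x + t k *: w - x) < c^-1.
  by apply: vcvg_near ci; apply: vcvg_line tc (@vcvg_cst _ _ w).
pose s k i := q i (x + t k *: w).
(* On the constrained indices this truncates the values of [q] to admissible ones, so the difference
   from them is exactly the violation. *)
pose y k : 'cV[R]_m := \col_i (if i \in F then 0 else
  if i \in A then s k i - (s k i + `|s k i|) / 2 else s k i).
have /choice[p hp] : forall k, exists p, vnorm (x + t k *: w - x) < c^-1 ->
    feas q F A p /\ vnorm (x + t k *: w - p) <= c * vnorm (\col_i s k i - y k).
  move=> k; have [h|h] := pselect (vnorm (x + t k *: w - x) < c^-1); last by exists 0.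
  have [p [pf _ hp]] := hc _ h; exists p => _; split => //; apply: hp => i iF.
    by rewrite mxE iF.
  rewrite mxE iF; case: ifP => // _.
  by have := ler_norm (s k i); lra.
have hs i : (t k)^-1 * (s k i - q i x) @[k --> ultra] --> vdot (g i x) w.
  by apply: gradient_quotient_cvg => //; exact: vcvg_cst.
have hy : vcvg (fun k => (t k)^-1 *: (\col_i s k i - y k)) 0.
  move=> i; rewrite mxE; have [iF|iF] := boolP (i \in F).
    rewrite -(wF i iF); apply: ultra_cvg_near_eq (hs i); apply: nearW => k.
    by rewrite !mxE iF subr0 hq ?inE ?iF // subr0.
  have [iA|iA] := boolP (i \in A); last first.
    apply: (@ultra_cvg_near_eq _ (fun=> 0)); last exact: cvg_cst.
    by apply: nearW => k; rewrite !mxE (negbTE iF) (negbTE iA) subrr mulr0.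
  have h0 : 0 = (vdot (g i x) w + `|vdot (g i x) w|) / 2.
    by rewrite ler0_norm ?wA // subrr mul0r.
  rewrite h0; apply: (@ultra_cvg_near_eq _ (fun k =>
    ((t k)^-1 * (s k i - q i x) + `|(t k)^-1 * (s k i - q i x)|) / 2)).
    apply: nearW => k; rewrite !mxE (negbTE iF) iA hq ?inE ?iA ?orbT // subr0.
    rewrite normrM gtr0_norm ?invr_gt0 //; ring.
  by apply: cvgM; [apply: cvgD => //; exact: cvg_norm | exact: cvg_cst].
exists (fun k => (t k)^-1 *: (p k - x)); last first.
  apply: filterS near_c => k /hp[pf _].
  by rewrite scalerA divff ?gt_eqF // scale1r addrC subrK.
apply: vcvg_eps => e e0.
have ec : 0 < e / c by rewrite divr_gt0.
near=> k.
have [|_ h] := hp k; first by near: k.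
have tk := t0 k.
have -> : (t k)^-1 *: (p k - x) - w = (t k)^-1 *: (p k - (x + t k *: w)).
  by rewrite opprD addrA [in RHS]scalerBr scalerA mulVf ?gt_eqF // scale1r.
rewrite vnormZ vnormC gtr0_norm ?invr_gt0 //.
apply: le_trans (_ : c * vnorm ((t k)^-1 *: (\col_i s k i - y k) - 0) <= _).
  rewrite subr0 vnormZ gtr0_norm ?invr_gt0 // mulrCA.
  by rewrite ler_wpM2l // invr_ge0 ltW.
rewrite mulrC -ler_pdivlMr //; apply: ltW; near: k; exact: vcvg_near.
Unshelve. all: by end_near. Qed.

Lemma q_neg_near i x : q i x < 0 -> exists d : R, 0 < d /\
  forall y, vnorm (y - x) < d -> q i y < 0.
Proof.
move=> q0; have [d [d0 hd]] := is_gradient_lipschitz (q_grad i x).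
have g1 : 0 < vnorm (g i x) + 1 by rewrite ltr_wpDl ?vnorm_ge0.
exists (Num.min d (- q i x / (vnorm (g i x) + 1))); split.
  by rewrite lt_min d0 divr_gt0 // oppr_gt0.
move=> y; rewrite lt_min => /andP[/hd h1]; rewrite ltr_pdivlMr // mulrC => h2.
by have := ler_norm (q i y - q i x); lra.
Qed.

Lemma inactive_near F A x : feas q F A x -> exists d : R, 0 < d /\
  forall y, vnorm (y - x) < d -> forall i, i \in A -> i \notin act A x -> q i y < 0.
Proof.
move=> [_ xA].
have [||d [d0 hd]] := @fin_radius R 'I_m (fun i d => forall y, vnorm (y - x) < d ->
  i \in A -> i \notin act A x -> q i y < 0).
- by move=> i d e le h y hy; apply: h; apply: lt_le_trans hy le.
- move=> i; have [/andP[iA iN]|h] := boolP ((i \in A) && (i \notin act A x)).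
    have [|d [d0 hd]] := @q_neg_near i x; last by exists d; split => // y /hd.
    by rewrite lt_neqAle xA // andbT; move: iN; rewrite inE iA.
  by exists 1; split => // y _ iA iN; rewrite iA iN in h.
by exists d; split => // y hy i; apply: hd.
Qed.

(** Turning the inequalities [P] into equalities only selects some of the families already
    controlled, and a smaller ball around [y] fits in the ball around [x]. *)
Lemma const_rank_sub F A x : const_rank g F A x -> exists d : R, 0 < d /\
  forall y, vnorm (y - x) < d -> forall P B, P :|: B \subset A -> const_rank g (F :|: P) B y.
Proof.
move=> [r [r0 hr]]; exists r; split => // y hy P B sPB.
exists (r - vnorm (y - x)); split; first by rewrite subr_gt0.
move=> C sCB z hz; rewrite -finset.setUA.
have sA : P :|: C \subset A by apply: fintype.subset_trans sPB; exact: finset.setUS.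
have zr : vnorm (z - x) < r.
  by apply: le_lt_trans (vnorm_triangle y _ _) _; move: hz; lra.
by rewrite !hr.
Qed.

End FeasibleSets.

Lemma const_rank_cst (R : realType) (n m : nat) (a : 'I_m -> 'cV[R]_n) F A x :
  const_rank (fun i _ => a i) F A x.
Proof. by exists 1. Qed.

Lemma vcontinuous_cst (R : realType) (n p : nat) (a : 'cV[R]_p) (x : 'cV[R]_n) :
  vcontinuous (fun=> a) x.
Proof. by move=> e e0; exists 1; split => // y _; rewrite subrr vnorm0 ltW. Qed.

Lemma is_gradient_vdot (R : realType) (n : nat) (a x : 'cV[R]_n) :
  is_gradient (vdot a) a x.
Proof.
move=> e e0; exists 1; split => // y _.
by rewrite vdotBr subrr normr0 mulr_ge0 ?vnorm_ge0 // ltW.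
Qed.

(* The projection of [z] onto the cone of admissible [w] vanishes (Moreau). *)
Lemma farkas (R : realType) (n m : nat) (a : 'I_m -> 'cV[R]_n) (F A : {set 'I_m})
    (z : 'cV[R]_n) :
  (forall w, (forall i, i \in F -> vdot (a i) w = 0) ->
    (forall i, i \in A -> vdot (a i) w <= 0) -> vdot z w <= 0) ->
  exists2 mu, mcone F A mu & z = \sum_i mu i 0 *: a i.
Proof.
move=> hz.
have [||c [c0 hc]] := @penalty_projection R n m (fun i => vdot (a i)) (fun i _ => a i)
  (fun i => is_gradient_vdot (a i)) (fun i => vcontinuous_cst (a i)) F A 0.
- exact: const_rank_cst.
- by split=> i _; rewrite vdot0r.
have z1 : 0 < vnorm z + 1 by rewrite ltr_wpDl ?vnorm_ge0.
(* The scaling brings [z] within the radius where the projection exists; a cone is insensitive to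
   it. *)
pose s := c^-1 / (vnorm z + 1).
have s0 : 0 < s by rewrite divr_gt0 ?invr_gt0.
have [|p [lam [[pF pA] [ls lp] lq e _]]] := hc (s *: z).
  rewrite subr0 vnormZ gtr0_norm // /s mulrAC ltr_pdivrMr // ltr_pM2l ?invr_gt0 //.
  by rewrite ltrDl.
(* Complementarity makes [p] orthogonal to the residual; since [p] is admissible, the hypothesis on
   [z] then forces [p = 0]. *)
have pp : vdot (s *: z - p) p = 0.
  by rewrite e vdot_comb big1.
have p0 : p = 0.
  apply: vdot_eq0; apply/eqP; rewrite eq_le vdot_ge0 andbT.
  move: pp; rewrite vdotBl vdotZl => /eqP; rewrite subr_eq0 => /eqP <-.
  by rewrite mulr_ge0_le0 ?hz // ltW.
exists (s^-1 *: lam).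
  split=> i iF; rewrite mxE; first by rewrite ls // mulr0.
  by rewrite mulr_ge0 ?lp // invr_ge0 ltW.
rewrite p0 subr0 in e; have s1 : s^-1 * s = 1 by rewrite mulVf // gt_eqF.
rewrite -[LHS]scale1r -s1 -scalerA e.
by rewrite /comb scaler_sumr; apply: eq_bigr => i _; rewrite mxE scalerA.
Qed.

(** * Tangent and normal cones of the feasible set through multipliers *)

Section NormalCones.
Variables (R : realType) (n m : nat).
Variables (q : 'I_m -> 'cV[R]_n -> R) (g : 'I_m -> 'cV[R]_n -> 'cV[R]_n).
Hypothesis q_grad : forall i x, is_gradient (q i) (g i x) x.
Hypothesis g_cont : forall i x, vcontinuous (g i) x.
Implicit Types (F A B : {set 'I_m}) (x y z u w : 'cV[R]_n).

Local Notation act := (act q).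

Lemma tangent_path_feas F A x w (t : nat -> R) : const_rank g F (act A x) x ->
  feas q F A x -> lin g F (act A x) x w ->
  (forall k, 0 < t k) -> t k @[k --> ultra] --> 0 ->
  exists2 u, vcvg u w & \forall k \near ultra, feas q F A (x + t k *: u k).
Proof.
move=> hr xf xw t0 tc.
have [|u uw hu] := tangent_path q_grad g_cont hr _ xw t0 tc.
  by move=> i; rewrite !inE => /orP[/xf.1//|/andP[_ /eqP]].
exists u => //; have [d [d0 hd]] := inactive_near q_grad xf.
have hl : vcvg (fun k => x + t k *: u k) x by exact: vcvg_line tc uw.
apply: filterS2 hu (vcvg_near hl d0) => k [h1 h2] h3.
split => // i iA; have [/h2//|h] := boolP (i \in act A x).
by apply: ltW; apply: (hd _ h3).
Qed.

Lemma tcone_feas_lin F A x w : feas q F A x -> tcone (feas q F A) x w ->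
  lin g F (act A x) x w.
Proof.
move=> [xF xA] [t [u [t0 /eventually_cvg0 tc /seq_cvg_vcvg uw hu]]].
have hq i := gradient_quotient_cvg (q_grad i x) t0 tc uw.
split=> i iF.
  apply/eqP; rewrite eq_le; apply/andP; split.
    by apply: (cvgr_to_le (hq i)); apply: nearW => k; rewrite (hu k).1 // xF // subrr mulr0.
  by apply: (cvgr_to_ge (hq i)); apply: nearW => k; rewrite (hu k).1 // xF // subrr mulr0.
move: iF; rewrite inE => /andP[iA /eqP qx].
apply: (cvgr_to_le (hq i)); apply: nearW => k; rewrite qx subr0.
by rewrite mulr_ge0_le0 ?invr_ge0 ?(ltW (t0 k)) // (hu k).2.
Qed.

Lemma tcone_feasP F A x w : const_rank g F (act A x) x -> feas q F A x ->
  tcone (feas q F A) x w <-> lin g F (act A x) x w.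
Proof.
move=> hr xf; split; first exact: tcone_feas_lin.
move=> xw; have t0 (k : nat) : 0 < k.+1%:R^-1 :> R by rewrite invr_gt0 ltr0n.
have [u uw hu] := tangent_path_feas hr xf xw t0 (@harmonic_ultra R).
exact: tcone_ultra t0 (@harmonic_ultra R) uw hu.
Qed.

Lemma mcone_rnormal F A x mu : feas q F A x -> mcone F (act A x) mu ->
  rnormal (feas q F A) x (comb g x mu).
Proof.
move=> [xF xA] [ms mp] e e0; set M := \sum_i `|mu i 0|.
have M0 : 0 <= M by apply: sumr_ge0.
have M1 : 0 < M + 1 by rewrite ltr_wpDl.
have eM : 0 < e / (M + 1) by rewrite divr_gt0.
have [d [d0 hd]] := @fin_radius R 'I_m
  (fun i d => forall y, vnorm (y - x) < d ->
     `|q i y - q i x - vdot (g i x) (y - x)| <= e / (M + 1) * vnorm (y - x))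
  (fun i d' e' le h y hy => h y (lt_le_trans hy le))
  (fun i => q_grad i x eM).
exists d; split => // y [yF yA] hy; rewrite vdot_comb.
apply: le_trans (_ : \sum_i `|mu i 0| * (e / (M + 1) * vnorm (y - x)) <= _).
  apply: ler_sum => i _.
  have h1 : mu i 0 * (q i y - q i x) <= 0.
    have [iF|iF] := boolP (i \in F); first by rewrite yF // xF // subrr mulr0.
    have [iA|iA] := boolP (i \in act A x); last by rewrite ms ?mul0r // inE negb_or iF.
    move: iA; rewrite inE => /andP[iA /eqP ->].
    by rewrite subr0 mulr_ge0_le0 ?mp ?yA.
  have h2 : - (mu i 0 * (q i y - q i x - vdot (g i x) (y - x))) <=
      `|mu i 0| * (e / (M + 1) * vnorm (y - x)).
    apply: le_trans (ler_norm _) _; rewrite normrN normrM ler_wpM2l //.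
    exact: hd.
  by move: h1 h2; rewrite !mulrBr; lra.
rewrite -mulr_suml -/M mulrA ler_wpM2r ?vnorm_ge0 // mulrCA ger_pMr //.
by rewrite ler_pdivrMr // mul1r lerDl.
Qed.

(** Testing a regular normal along feasible paths shows that it pairs nonpositively with every
    linearised direction; Farkas then gives the multipliers. *)
Lemma rnormal_mcone F A x z : const_rank g F (act A x) x -> feas q F A x ->
  rnormal (feas q F A) x z -> exists2 mu, mcone F (act A x) mu & z = comb g x mu.
Proof.
move=> hr xf hz; apply: farkas => w wF wA.
have t0 (k : nat) : 0 < k.+1%:R^-1 :> R by rewrite invr_gt0 ltr0n.
have tc := @harmonic_ultra R.
have [u uw hu] := tangent_path_feas hr xf (conj wF wA) t0 tc.
apply/ler_addgt0Pr => e e0; rewrite add0r.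
have w1 : 0 < vnorm w + 1 by rewrite ltr_wpDl ?vnorm_ge0.
have e1 : 0 < e / (vnorm w + 1) by rewrite divr_gt0.
have [d [d0 hd]] := hz _ e1.
have h1 : vdot z (u k) @[k --> ultra] --> vdot z w.
  by apply: (ultra_cvg_vdot (u := fun=> z)) => //; exact: vcvg_cst.
have h2 : e / (vnorm w + 1) * vnorm (u k) @[k --> ultra] --> e / (vnorm w + 1) * vnorm w.
  by apply: cvgM; [exact: cvg_cst | exact: ultra_cvg_vnorm].
apply: le_trans (_ : e / (vnorm w + 1) * vnorm w <= _); last first.
  by rewrite mulrAC ler_pdivrMr // ler_wpM2l ?(ltW e0) // lerDl.
apply: (ler_cvg_to h1 h2).
have hl : vcvg (fun k => x + k.+1%:R^-1 *: u k) x by exact: vcvg_line tc uw.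
apply: filterS2 hu (vcvg_near hl d0) => k h3 h4.
have := hd _ h3 h4; rewrite [x + _]addrC addrK vdotZr vnormZ gtr0_norm //.
by rewrite mulrCA ler_pM2l.
Qed.

Lemma mcone_lnormal F A x mu : feas q F A x -> mcone F (act A x) mu ->
  lnormal (feas q F A) x (comb g x mu).
Proof.
move=> xf hmu; split => //; exists (fun=> x), (fun=> comb g x mu); split => //.
- by move=> e e0; exists 0%N => k _; rewrite subrr vnorm0.
- by move=> _; exact: mcone_rnormal.
- by move=> e e0; exists 0%N => k _; rewrite subrr vnorm0.
Qed.

(** Near [x] active sets are contained in that of [x], so regular normals at nearby points have
    multipliers of the same sign pattern, and closedness handles the limit. *)
Lemma lnormal_feasP F A x z : const_rank g F (act A x) x -> feas q F A x ->
  lnormal (feas q F A) x z <-> exists2 mu, mcone F (act A x) mu & z = comb g x mu.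
Proof.
move=> hr xf; split; last by move=> [mu hmu ->]; exact: mcone_lnormal.
move=> [_ [y [zs [yf /seq_cvg_vcvg yx yn /seq_cvg_vcvg zz]]]].
have [d1 [d10 hd1]] := inactive_near q_grad xf.
have [d2 [d20 hd2]] := const_rank_sub hr.
have hmu k : exists mu, vnorm (y k - x) < d1 -> vnorm (y k - x) < d2 ->
    mcone F (act A x) mu /\ zs k = comb g (y k) mu.
  have [h1|h1] := pselect (vnorm (y k - x) < d1); last by exists 0.
  have [h2|h2] := pselect (vnorm (y k - x) < d2); last by exists 0.
  have sA : act A (y k) \subset act A x.
    apply/fintype.subsetP => i; rewrite inE => /andP[iA /eqP qi].
    by apply: contraT => iN; have := hd1 _ h1 i iA iN; rewrite qi ltxx.
  have [|mu [ms mp] e] := rnormal_mcone _ (yf k) (yn k).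
  - by have := hd2 _ h2 finset.set0 (act A (y k)); rewrite finset.setU0 finset.set0U; apply.
  - exists mu => _ _; split => //; split => // i; rewrite inE negb_or => /andP[iF iA].
    by apply: ms; rewrite inE negb_or iF (contraNN (fintype.subsetP sA i)).
have [mu {}hmu] := choice hmu.
apply: (comb_mcone_closed (mu := mu) g_cont hr yx).
  apply: filterS2 (vcvg_near yx d10) (vcvg_near yx d20) => k h1 h2.
  by have [] := hmu k h1 h2.
apply: vcvg_near_eq zz.
apply: filterS2 (vcvg_near yx d10) (vcvg_near yx d20) => k h1 h2.
by have [] := hmu k h1 h2.
Qed.

End NormalCones.

(** * Second-order analysis *)

Section SecondOrder.
Variables (R : realType) (n m : nat).
Variables (q : 'I_m -> 'cV[R]_n -> R) (g : 'I_m -> 'cV[R]_n -> 'cV[R]_n).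
Variable H : 'I_m -> 'cV[R]_n -> 'M[R]_n.
Hypothesis q_grad : forall i x, is_gradient (q i) (g i x) x.
Hypothesis g_jac : forall i x, is_jacobian (g i) (H i x) x.
Implicit Types (F A B : {set 'I_m}) (x y z u w : 'cV[R]_n) (lam mu : 'cV[R]_m).

Local Notation act := (act q).

Let g_cont i x : vcontinuous (g i) x.
Proof. exact: jacobian_continuous. Qed.

Definition hess lam x : 'M[R]_n := \sum_i lam i 0 *: H i x.

Lemma comb_quotient_cvg lam x w (t : nat -> R) (u : nat -> 'cV[R]_n) :
  (forall k, 0 < t k) -> t k @[k --> ultra] --> 0 -> vcvg u w ->
  vcvg (fun k => (t k)^-1 *: (comb g (x + t k *: u k) lam - comb g x lam))
    (hess lam x *m w).
Proof.
move=> t0 tc uw.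
have -> : hess lam x *m w = \sum_i lam i 0 *: (H i x *m w).
  by rewrite mulmx_suml; apply: eq_bigr => i _; rewrite scalemxAl.
have -> : (fun k => (t k)^-1 *: (comb g (x + t k *: u k) lam - comb g x lam)) =
    fun k => \sum_i lam i 0 *: ((t k)^-1 *: (g i (x + t k *: u k) - g i x)).
  apply/funext => k; rewrite /comb -sumrB scaler_sumr; apply: eq_bigr => i _.
  by rewrite -scalerBr !scalerA mulrC.
apply: vcvg_sum => i; apply: (vcvgZ (t := fun=> lam i 0)); first exact: cvg_cst.
exact: jacobian_quotient_cvg.
Qed.

(* The quotients of the vanishing combination along x + t w stay in the span of
   the gradients, which is closed under limits since its rank is constant. *)
Lemma hess_span F x eta w : const_rank g F finset.set0 x -> supp_in F eta ->
  comb g x eta = 0 -> exists2 mu, supp_in F mu & hess eta x *m w = comb g x mu.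
Proof.
move=> hr hs h0.
have t0 (k : nat) : 0 < k.+1%:R^-1 :> R by rewrite invr_gt0 ltr0n.
have tc := @harmonic_ultra R.
have hw := @vcvg_cst R n w.
have hl : vcvg (fun k => x + k.+1%:R^-1 *: w) x by exact: vcvg_line tc hw.
have [mu [ms _] e] : exists2 mu, mcone F finset.set0 mu & hess eta x *m w = comb g x mu.
  apply: (comb_mcone_closed (mu := fun k => k.+1%:R^-1^-1 *: eta) g_cont hr hl).
    apply: nearW => k; split=> i iF; rewrite mxE hs ?mulr0 //.
    by move: iF; rewrite finset.setU0.
  have hq := @comb_quotient_cvg eta x w _ (fun=> w) t0 tc hw.
  apply: vcvg_near_eq hq.
  by apply: nearW => k; rewrite h0 subr0 comb_scale.
by exists mu => // i iF; apply: ms; rewrite finset.setU0.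
Qed.

(** The pairing of [comb g x lam] with [w] is a sum of nonpositive terms, so it vanishes only if
    each does; active inequalities with nonzero multiplier thus become equalities. *)
Lemma crit_lin F A x lam w : mcone F (act A x) lam ->
  lin g F (act A x) x w /\ vdot (comb g x lam) w = 0 <->
  lin g (F :|: [set i in act A x | lam i 0 != 0]%SET)
    (act A x :\: [set i in act A x | lam i 0 != 0]%SET) x w.
Proof.
move=> [ls lp]; split.
  move=> [[wF wA]]; rewrite vdot_comb => h0; split=> i.
    rewrite !inE => /orP[/wF//|/andP[iA li]].
    have [/wF//|iF] := boolP (i \in F).
    have h j : true -> 0 <= - (lam j 0 * vdot (g j x) w).
      move=> _; have [jF|jF] := boolP (j \in F); first by rewrite wF // mulr0 oppr0.
      have [jA|jA] := boolP (j \in act A x); last first.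
        by rewrite ls ?mul0r ?oppr0 // finset.in_setU negb_or jF.
      by rewrite oppr_ge0 mulr_ge0_le0 ?lp ?wA.
    have /eqP : \sum_j - (lam j 0 * vdot (g j x) w) = 0 by rewrite sumrN h0 oppr0.
    rewrite psumr_eq0 // => /allP/(_ i); rewrite mem_index_enum => /(_ isT) /=.
    by rewrite oppr_eq0 mulf_eq0 (negbTE li) => /eqP.
  by rewrite finset.in_setD => /andP[_]; exact: wA.
move=> [wF wA]; split; first split=> i iF.
- by apply: wF; rewrite finset.in_setU iF.
- have [iP|iP] := boolP (i \in [set i in act A x | lam i 0 != 0]%SET).
    by rewrite wF // finset.in_setU iP orbT.
  by apply: wA; rewrite finset.in_setD iP.
rewrite vdot_comb big1 // => i _; have [iF|iF] := boolP (i \in F).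
  by rewrite wF ?mulr0 // finset.in_setU iF.
have [iA|iA] := boolP (i \in act A x); last first.
  by rewrite ls ?mul0r // finset.in_setU negb_or iF.
have [->|li] := eqVneq (lam i 0) 0; first by rewrite mul0r.
by rewrite wF ?mulr0 // finset.in_setU finset.in_set iA li orbT.
Qed.

(** * Tangent cone to the graph of the normal cone map *)

Section GraphTangent.
Variables (F A : {set 'I_m}) (x : 'cV[R]_n) (lam : 'cV[R]_m).
Hypothesis x_feas : feas q F A x.
Hypothesis x_rank : const_rank g F (act A x) x.
Hypothesis lam_cone : mcone F (act A x) lam.

(** [P] holds the strongly active inequalities, so [lin g F1 A1 x] is the critical cone. [C w] holds
    the inequalities that may stay tight along a path with direction [w], and [mcone F1 (C1 w)]
    yields the normals to the critical cone at [w]. *)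
Let P := [set i in act A x | lam i 0 != 0]%SET.
Let F1 := F :|: P.
Let A1 := act A x :\: P.
Let C w := [set i in act A x | vdot (g i x) w == 0]%SET.
Let C1 w := [set i in A1 | vdot (g i x) w == 0]%SET.

Let neg_near w (t : nat -> R) (u : nat -> 'cV[R]_n) :
  lin g F (act A x) x w ->
  (forall k, 0 < t k) -> t k @[k --> ultra] --> 0 -> vcvg u w ->
  \forall k \near ultra, forall i, i \in A -> i \notin C w -> q i (x + t k *: u k) < 0.
Proof.
move=> [wF wA] t0 tc uw; apply: filter_forall => i.
have [iA|iA] := boolP (i \in A); last by apply: nearW.
have [iC|iC] := boolP (i \in C w); first by apply: nearW.
have hl : vcvg (fun k => x + t k *: u k) x by exact: vcvg_line tc uw.
have [iact|iact] := boolP (i \in act A x); last first.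
  have [d [d0 hd]] := inactive_near q_grad x_feas.
  by apply: filterS (vcvg_near hl d0) => k h _ _; apply: hd h i iA iact.
have w0 : vdot (g i x) w < 0.
  by rewrite lt_neqAle wA // andbT; move: iC; rewrite finset.in_set iact.
have hq := gradient_quotient_cvg (q_grad i x) t0 tc uw.
apply: filterS (cvgr_lt _ hq _ w0) => k + _ _.
move: iact; rewrite finset.in_set => /andP[_ /eqP ->].
by rewrite subr0 pmulr_rlt0 // invr_gt0.
Qed.

Let lam_off i : i \notin F1 -> lam i 0 = 0.
Proof.
rewrite !finset.in_setU negb_or finset.in_set negb_and negbK => /andP[iF /orP[iA|/eqP//]].
by apply: lam_cone.1; rewrite finset.in_setU negb_or iF.
Qed.

(** Multipliers [nu k] of the perturbed normals are compared with [lam]: the quotient of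
    [nu k - lam] by [t k] has the signs of [mcone F1 (C1 w)], and the change of gradients
    contributes the Hessian term. *)
Lemma graph_tangent_sub w z :
  tcone2 (gph (lnormal (feas q F A))) (x, comb g x lam) (w, z) ->
  lin g F1 A1 x w /\
  exists2 mu, mcone F1 (C1 w) mu & z = hess lam x *m w + comb g x mu.
Proof.
move=> [t [u [v [/= t0 tc0 uw0 vz0 hS]]]].
have tc := eventually_cvg0 tc0; have uw := seq_cvg_vcvg uw0.
have vz := seq_cvg_vcvg vz0.
have hl : vcvg (fun k => x + t k *: u k) x by exact: vcvg_line tc uw.
have xk k : feas q F A (x + t k *: u k) by have [] := hS k.
have xw : lin g F (act A x) x w.
  by apply: (tcone_feas_lin q_grad x_feas); exists t, u; split.
have [d [d0 hd]] := const_rank_sub x_rank.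
have ranks (Q B : {set 'I_m}) : Q :|: B \subset act A x -> const_rank g (F :|: Q) B x.
  by apply: hd; rewrite subrr vnorm0.
have nneg := neg_near xw t0 tc uw.
have hlam k : exists mu, vnorm (x + t k *: u k - x) < d ->
    (forall i, i \in A -> i \notin C w -> q i (x + t k *: u k) < 0) ->
    mcone F (C w) mu /\ comb g x lam + t k *: v k = comb g (x + t k *: u k) mu.
  have [h1|h1] := pselect (vnorm (x + t k *: u k - x) < d); last by exists 0.
  have [h2|h2] := pselect (forall i, i \in A -> i \notin C w -> q i (x + t k *: u k) < 0);
    last by exists 0.
  have sA : act A (x + t k *: u k) \subset C w.
    apply/fintype.subsetP => i; rewrite finset.in_set => /andP[iA /eqP qi].
    by apply: contraT => iC; have := h2 i iA iC; rewrite qi ltxx.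
  have sC : C w \subset act A x by apply/fintype.subsetP => i; rewrite finset.in_set => /andP[].
  have rk : const_rank g F (act A (x + t k *: u k)) (x + t k *: u k).
    have := hd _ h1 finset.set0 (act A (x + t k *: u k)).
    by rewrite finset.setU0 finset.set0U; apply; apply: fintype.subset_trans sA sC.
  have := hS k; rewrite /gph /= => /(lnormal_feasP q_grad g_cont _ rk (xk k))[mu [ms mp] e].
  exists mu => _ _; split => //; split => // i.
  rewrite finset.in_setU negb_or => /andP[iF iC]; apply: ms.
  by rewrite finset.in_setU negb_or iF (contraNN (fintype.subsetP sA i)).
have {hlam}[nu hnu] := choice hlam.
have {nneg}hnu : \forall k \near ultra, mcone F (C w) (nu k) /\
    comb g x lam + t k *: v k = comb g (x + t k *: u k) (nu k).
  by apply: filterS2 nneg (vcvg_near hl d0) => k h1 h2; exact: hnu.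
have sC : C w \subset act A x by apply/fintype.subsetP => i; rewrite finset.in_set => /andP[].
have hF1 : lin g F1 A1 x w.
  apply/(crit_lin _ lam_cone); split => //.
  (* In the limit [comb g x lam] is also a combination of gradients in [F :|: C w], all orthogonal
     to [w]; hence [w] is critical. *)
  have [||||mu [ms mp] ->] := @comb_mcone_closed R n m g g_cont F (C w) x
    (fun k => x + t k *: u k) nu (comb g x lam).
  - by have := ranks finset.set0 (C w); rewrite finset.setU0 finset.set0U; apply.
  - exact: hl.
  - by apply: filterS hnu => k [].
  - apply: (@vcvg_near_eq _ _ (fun k => comb g x lam + t k *: v k)).
      by apply: filterS hnu => k [].
    exact: vcvg_line tc vz.
  rewrite vdot_comb big1 // => i _; have [/xw.1 ->|iF] := boolP (i \in F).
    by rewrite mulr0.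
  have [|iC] := boolP (i \in C w).
    by rewrite finset.in_set => /andP[_ /eqP ->]; rewrite mulr0.
  by rewrite ms ?mul0r // finset.in_setU negb_or iF.
split => //.
have [||||mu hmu e] := @comb_mcone_closed R n m g g_cont F1 (C1 w) x
    (fun k => x + t k *: u k) (fun k => (t k)^-1 *: (nu k - lam))
    (z - hess lam x *m w).
- apply: ranks; apply/fintype.subsetP => i; rewrite finset.in_setU !finset.in_set.
  by move=> /orP[/andP[//]|/andP[/andP[]]].
- exact: hl.
(* Off [F1] the multiplier [lam] vanishes, so the difference inherits the sign of [nu k]; on [F1] no
   sign is required. *)
- apply: filterS hnu => k [[ns np] _]; split=> i.
    rewrite finset.in_setU negb_or => /andP[iF1 iC1].
    move: (iF1); rewrite finset.in_setU negb_or => /andP[iF iP].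
    rewrite !mxE (lam_off iF1) ns ?subrr ?mulr0 // finset.in_setU negb_or iF.
    apply: contraNN iC1; rewrite [i \in C w]finset.in_set => /andP[iA iw].
    by rewrite finset.in_set finset.in_setD iP iA.
  move=> iF1; move: (iF1); rewrite finset.in_setU negb_or => /andP[iF iP].
  by rewrite !mxE (lam_off iF1) subr0 mulr_ge0 ?np // invr_ge0 ltW.
- have hq := vcvgB vz (@comb_quotient_cvg lam x w t u t0 tc uw).
  apply: vcvg_near_eq hq.
  apply: filterS hnu => k [_ hk]; rewrite comb_scale comb_sub -hk.
  rewrite -[v k in LHS]scale1r -(mulVf (lt0r_neq0 (t0 k))) -scalerA -scalerBr.
  by congr (_ *: _); rewrite opprB addrA; congr (_ - _); rewrite addrC.
by exists mu => //; rewrite -e addrC subrK.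
Qed.

(** All of [C w] is treated as equalities along the path, so any multiplier supported there is
    complementary, and [lam + t mu] is normal for small [t]. *)
Lemma graph_tangent_sup w mu : lin g F1 A1 x w -> mcone F1 (C1 w) mu ->
  tcone2 (gph (lnormal (feas q F A))) (x, comb g x lam)
    (w, hess lam x *m w + comb g x mu).
Proof.
move=> hF1 [ms mp].
have /(crit_lin _ lam_cone)[xw _] := hF1.
have t0 (k : nat) : 0 < k.+1%:R^-1 :> R by rewrite invr_gt0 ltr0n.
have tc := @harmonic_ultra R.
have sC : C w \subset act A x by apply/fintype.subsetP => i; rewrite finset.in_set => /andP[].
have PC i : i \in P -> i \in C w.
  move=> iP; move: (iP); rewrite !finset.in_set => /andP[-> _] /=; apply/eqP.
  by apply: hF1.1; rewrite finset.in_setU iP orbT.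
have [d [d0 hd]] := const_rank_sub x_rank.
have rC : const_rank g (F :|: C w) finset.set0 x.
  by apply: hd; rewrite ?subrr ?vnorm0 // finset.setU0.
have [||u uw hu] := @tangent_path R n m q g q_grad g_cont _ _ x w _ rC _ _ t0 tc.
- move=> i; rewrite finset.setU0 finset.in_setU => /orP[/x_feas.1//|/(fintype.subsetP sC)].
  by rewrite finset.in_set => /andP[_ /eqP].
- split=> i; last by rewrite finset.in_set0.
  by rewrite finset.in_setU => /orP[/xw.1//|]; rewrite finset.in_set => /andP[_ /eqP].
have hl : vcvg (fun k => x + k.+1%:R^-1 *: u k) x by exact: vcvg_line tc uw.
pose v (k : nat) := k.+1%:R^-1^-1 *: (comb g (x + k.+1%:R^-1 *: u k) lam - comb g x lam)
  + comb g (x + k.+1%:R^-1 *: u k) mu.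
have hv : vcvg v (hess lam x *m w + comb g x mu).
  apply: vcvgD; first exact: comb_quotient_cvg.
  by apply: vcvg_comb => //; exact: vcvg_cst.
apply: (tcone2_ultra t0 tc uw hv).
have nneg := neg_near xw t0 tc uw.
(* On [P] the entry of [mu] may be negative, but that of [lam] is positive and dominates for small
   steps. *)
have pos : \forall k \near ultra, forall i, i \in P -> i \notin F ->
    0 <= lam i 0 + k.+1%:R^-1 * mu i 0.
  apply: filter_forall => i; have [iP|iP] := boolP (i \in P); last by apply: nearW.
  have [iF|iF] := boolP (i \in F); first by apply: nearW.
  have li : 0 < lam i 0.
    rewrite lt_neqAle eq_sym lam_cone.2 // andbT.
    by move: iP; rewrite finset.in_set => /andP[].
  have hc : lam i 0 + k.+1%:R^-1 * mu i 0 @[k --> ultra] --> lam i 0 + 0 * mu i 0.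
    by apply: cvgD; [exact: cvg_cst | apply: cvgM => //; exact: cvg_cst].
  rewrite mul0r addr0 in hc.
  by apply: filterS (cvgr_gt _ hc _ li) => k /ltW.
apply: filterS3 hu nneg pos => k [uF _] un up.
rewrite /gph /=.
have -> : comb g x lam + k.+1%:R^-1 *: v k =
    comb g (x + k.+1%:R^-1 *: u k) (lam + k.+1%:R^-1 *: mu).
  rewrite /v scalerDr scalerA divff ?gt_eqF // scale1r comb_add comb_scale.
  by rewrite addrA [comb g x lam + _]addrC subrK.
have xkf : feas q F A (x + k.+1%:R^-1 *: u k).
  split=> i iF; first by apply: uF; rewrite finset.in_setU iF.
  have [iC|iC] := boolP (i \in C w); last exact: ltW (un i iF iC).
  by rewrite uF // finset.in_setU iC orbT.
apply: (mcone_lnormal q_grad xkf); split=> i.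
  rewrite finset.in_setU negb_or => /andP[iF iact].
  have iC : i \notin C w.
    apply: contraNN iact => iC; rewrite finset.in_set uF ?eqxx ?andbT.
      by move: (fintype.subsetP sC i iC); rewrite finset.in_set => /andP[].
    by rewrite finset.in_setU iC orbT.
  have iF1 : i \notin F1.
    by rewrite finset.in_setU negb_or iF (contraNN (PC i)).
  rewrite !mxE (lam_off iF1) add0r ms ?mulr0 //.
  rewrite finset.in_setU negb_or iF1 /=; apply: contraNN iC.
  rewrite finset.in_set => /andP[]; rewrite finset.in_setD => /andP[_ iA] h.
  by rewrite finset.in_set iA.
move=> iF; rewrite !mxE; have [iP|iP] := boolP (i \in P); first exact: up.
have iF1 : i \notin F1 by rewrite finset.in_setU negb_or iF.
by rewrite (lam_off iF1) add0r mulr_ge0 ?mp // ltW.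
Qed.

End GraphTangent.
End SecondOrder.

(** * The constraint system of the theorem *)

Section ConstraintSystem.
Variables (R : realType) (n l1 l2 : nat).
Variable q : 'I_(l1 + l2) -> 'cV[R]_n -> R.
Variable dq : 'I_(l1 + l2) -> 'cV[R]_n -> 'cV[R]_n.

Definition eqs : {set 'I_(l1 + l2)} := [set i : 'I_(l1 + l2) | (i < l1)%N]%SET.
Definition ineqs : {set 'I_(l1 + l2)} := [set i : 'I_(l1 + l2) | (l1 <= i)%N]%SET.

Lemma notin_eqs i : (i \notin eqs) = (l1 <= i)%N.
Proof. by rewrite finset.in_set -leqNgt. Qed.

Lemma Gamma_feas : Gamma q = feas q eqs ineqs.
Proof.
apply/seteqP; split=> x.
  move=> h; split=> i; rewrite finset.in_set => hi; have := h i; rewrite mxE.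
    by rewrite hi.
  by rewrite ltnNge hi.
move=> [hE hI] i; rewrite mxE; case: ifP => hi.
  by apply: hE; rewrite finset.in_set.
by apply: hI; rewrite finset.in_set leqNgt hi.
Qed.

Lemma active_act x : active q x = act q ineqs x.
Proof. by apply/finset.setP => i; rewrite !finset.in_set. Qed.

Lemma RCRCQ_const_rank x : RCRCQ q dq x -> const_rank dq eqs (act q ineqs x) x.
Proof.
have e J y : grad_rows dq (eqs :|: J) y = gradmx dq J y.
  by apply/matrixP => i j; rewrite !mxE finset.in_setU finset.in_set.
move=> [r [r0 hr]]; exists r; split => // J; rewrite -active_act => sJ y hy.
by rewrite !e hr.
Qed.

Lemma LagrP x xs lam :
  Lagr q dq x xs lam <-> mcone eqs (act q ineqs x) lam /\ comb dq x lam = xs.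
Proof.
split=> [[hs hp]|[[ms mp] hs]].
  split => //; split=> i; rewrite ?finset.in_setU ?negb_or notin_eqs.
    move=> /andP[hi]; rewrite finset.in_set finset.in_set hi /= => qi.
    by have /eqP := (hp i hi).2; rewrite mulf_eq0 (negbTE qi) orbF => /eqP.
  by move=> /hp[].
split => // i hi; split; first by apply: mp; rewrite notin_eqs.
have [/eqP ->|qi] := boolP (q i x == 0); first by rewrite mulr0.
rewrite ms ?mul0r // finset.in_setU negb_or notin_eqs hi finset.in_set.
by rewrite (negbTE qi) andbF.
Qed.

End ConstraintSystem.

(** * Uniform radius and modulus near [xb], and the four conclusions at each nearby feasible
    point *)

Theorem theorem3p1 (R : realType) (n l1 l2 : nat)
  (q : 'I_(l1 + l2) -> 'cV[R]_n -> R)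
  (dq : 'I_(l1 + l2) -> 'cV[R]_n -> 'cV[R]_n)
  (d2q : 'I_(l1 + l2) -> 'cV[R]_n -> 'M[R]_n)
  (Hdq : forall i x, is_gradient (q i) (dq i x) x)
  (Hd2q : forall i x, is_jacobian (dq i) (d2q i x) x)
  (Hcont : forall i, mx_continuous (d2q i))
  (Hl : (0 < l1 + l2)%N)
  (xb : 'cV[R]_n) (Hxb : Gamma q xb) (HRC : RCRCQ q dq xb) :
  exists (delta gam : R), 0 < delta /\ 0 < gam /\
    forall x, Gamma q x -> vnorm (x - xb) < delta ->
      [/\ MSCQ q x gam,
        (* (i) *)
        (forall xs v : 'cV[R]_n,
            (forall i : 'I_(l1 + l2), (i < l1)%N \/ Iplus q dq x xs i ->
               vdot (dq i x) v = 0) ->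
            LagrV q dq d2q x xs v = Lagr q dq x xs),
        (* (ii) *)
        (forall (xs : 'cV[R]_n) lam, Lagr q dq x xs lam ->
            tcone2 (gph (NGamma q)) (x, xs) =
            [set wz | exists2 nu, lnormal (critcone q x xs) wz.1 nu &
                        wz.2 = hessL d2q lam x *m wz.1 + nu])
        & (* (iii) *)
        (forall xs : 'cV[R]_n, Lagr q dq x xs !=set0 ->
            exists lam, [/\ Lagr q dq x xs lam, vnorm lam <= gam * vnorm xs &
              forall w z, gderiv (NGamma q) x xs w z ->
                exists2 nu, lnormal (critcone q x xs) w nu &
                            z = hessL d2q lam x *m w + nu])].
Proof.
have dq_cont i x : vcontinuous (dq i) x by exact: jacobian_continuous.
have rk := RCRCQ_const_rank HRC.
have xbf : feas q (eqs l1 l2) (ineqs l1 l2) xb by rewrite -Gamma_feas.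
set E := eqs l1 l2 in rk xbf *; set I := ineqs l1 l2 in rk xbf *.
have [d1 [d10 hd1]] := inactive_near Hdq xbf.
have [d2 [d20 hd2]] := const_rank_sub rk.
(* The rank condition concerns only inequalities active at [xb], so the error bound is taken for the
   system without the others. *)
have xbf' : feas q E (act q I xb) xb.
  by split; [exact: xbf.1 | move=> i; rewrite finset.in_set => /andP[_ /eqP ->]].
have [c1 [c10 hc1]] := error_bound Hdq dq_cont rk xbf'.
have [c2 [c20 hc2]] := bounded_multipliers dq_cont rk.
(* A point [u] within [delta] of [x] is within [2 * delta] of [xb], and its approximation [p] within
   [4 * delta]; hence the fractions of [c1^-1] and [d1]. *)
pose delta := Num.min (Num.min (d1 / 4) d2) (Num.min (c1^-1 / 2) c2^-1).
have delta0 : 0 < delta by rewrite !lt_min d20 !divr_gt0 ?invr_gt0.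
have le_delta : [/\ delta <= d1 / 4, delta <= d2, delta <= c1^-1 / 2 & delta <= c2^-1].
  by rewrite /delta !ge_min !lexx !orbT.
have [le1 le2 le3 le4] := le_delta.
exists delta, (c1 + c2); split => //; split; first exact: addr_gt0.
move=> x Gx hx; have xf : feas q E I x by move: Gx; rewrite Gamma_feas.
have sact : act q I x \subset act q I xb.
  apply/fintype.subsetP => i; rewrite finset.in_set => /andP[iI /eqP qi].
  apply: contraT => iN; have xd1 : vnorm (x - xb) < d1 by lra.
  by have := hd1 x xd1 i iI iN; rewrite qi ltxx.
have ranks (P B : {set 'I_(l1 + l2)}) : P :|: B \subset act q I x ->
    const_rank dq (E :|: P) B x.
  move=> sPB; apply: hd2; first exact: lt_le_trans hx le2.
  exact: fintype.subset_trans sPB sact.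
have rkx : const_rank dq E (act q I x) x.
  by have := ranks finset.set0 (act q I x); rewrite finset.setU0 finset.set0U; apply.
have graph xs lam : Lagr q dq x xs lam ->
    tcone2 (gph (NGamma q)) (x, xs) =
    [set wz | exists2 nu, lnormal (critcone q x xs) wz.1 nu &
                wz.2 = hessL d2q lam x *m wz.1 + nu].
  move=> /LagrP[lc <-]; rewrite /NGamma Gamma_feas -/E -/I.
  pose P := [set i in act q I x | lam i 0 != 0]%SET.
  (* The critical cone is itself a feasible set, with linear constraints of constant gradient, so
     the normal cone formula applies to it. *)
  have -> : critcone q x (comb dq x lam) =
      feas (fun i => vdot (dq i x)) (E :|: P) (act q I x :\: P).
    apply/seteqP; split=> w.
      rewrite /critcone Gamma_feas => -[/(tcone_feasP Hdq dq_cont w rkx xf) h1 h2].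
      exact/(crit_lin dq w lc).
    move=> /(crit_lin dq w lc)[h1 h2]; split => //; rewrite Gamma_feas.
    exact/(tcone_feasP Hdq dq_cont w rkx xf).
  have normals w := @lnormal_feasP R n (l1 + l2) (fun i => vdot (dq i x))
    (fun i _ => dq i x) (fun i => is_gradient_vdot (dq i x))
    (fun i => vcontinuous_cst (dq i x)) (E :|: P) (act q I x :\: P) w.
  apply/seteqP; split=> [[w z]|[w z] /= [nu hnu ->]].
    move=> /(graph_tangent_sub Hdq Hd2q xf rkx lc)[hw [mu hmu ->]] /=.
    exists (comb dq x mu) => //; apply/normals => //; first exact: const_rank_cst.
    by exists mu.
  have [hw _] := hnu.
  have /normals[||mu hmu ->] := hnu => //; first exact: const_rank_cst.
  exact: (graph_tangent_sup Hdq Hd2q xf rkx lc hw hmu).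
split => //.
- exists delta; split => // u hu.
  have uxb : vnorm (u - xb) < 2 * delta.
    by apply: le_lt_trans (vnorm_triangle x _ _) _; lra.
  have [|p [[pE pI] pn hp]] := hc1 u; first by lra.
  (* The omitted inequalities are negative at [p], which lies within [d1] of [xb]. *)
  have Gp : Gamma q p.
    rewrite Gamma_feas; split=> // i iI.
    have [/pI//|iN] := boolP (i \in act q I xb).
    apply: ltW; apply: hd1 iI iN; apply: le_lt_trans (vnorm_triangle u _ _) _.
    by rewrite vnormC; apply: le_lt_trans (lerD pn (lexx _)) _; lra.
  have c12 : 0 < c1 + c2 by exact: addr_gt0.
  apply: le_trans (_ : vnorm (u - p) <= _).
    apply: ge_inf; last by exists p.
    by exists 0 => _ [y _ <-]; exact: vnorm_ge0.
  (* Dividing by the modulus leaves a lower bound of an infimum, checked at each point of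
     [Theta]. *)
  rewrite mulrC -ler_pdivrMr //; apply: lb_le_inf.
    exists (vnorm (qv q u - 0)), 0 => //= i; rewrite mxE; by case: ifP.
  move=> _ [y hy <-]; rewrite ler_pdivrMr // mulrC.
  apply: le_trans (hp y _ _) _.
  + by move=> i; rewrite finset.in_set => hi; have := hy i; rewrite hi.
  + move=> i; rewrite finset.in_set => /andP[]; rewrite finset.in_set => hi _.
    by have := hy i; rewrite ltnNge hi.
  + by rewrite ler_wpM2r ?vnorm_ge0 // lerDl ltW.
- move=> xs v hv; apply/seteqP; split=> [lam []//|lam hlam]; split => // mu hmu.
  have /LagrP[[ls lp] le] := hlam; have /LagrP[[ms mp] me] := hmu.
  (* Gradients in [E :|: P] are orthogonal to [v], and the Hessian of [mu - lam] maps [v] into their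
     span; so the quadratic form takes equal values at [lam] and [mu]. *)
  pose P := [set i in act q I x | (lam i 0 != 0) || (mu i 0 != 0)]%SET.
  have hP : const_rank dq (E :|: P) finset.set0 x.
    apply: ranks; rewrite finset.setU0; apply/fintype.subsetP => i.
    by rewrite finset.in_set => /andP[].
  have hs : supp_in (E :|: P) (mu - lam).
    move=> i; rewrite finset.in_setU negb_or [i \in P]finset.in_set negb_and => /andP[iE].
    rewrite !mxE negb_or !negbK => /orP[iA|/andP[/eqP -> /eqP ->]]; last by rewrite subrr.
    have iEA : i \notin E :|: act q I x by rewrite finset.in_setU negb_or iE.
    by rewrite ls // ms // subrr.
  have [|nu ns hnu] := hess_span Hd2q v hP hs; first by rewrite comb_sub le me subrr.
  have vnu : vdot (hess d2q (mu - lam) x *m v) v = 0.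
    rewrite hnu vdot_comb big1 // => i _.
    have [|iEP] := boolP (i \in E :|: P); last by rewrite ns ?mul0r.
    rewrite finset.in_setU !finset.in_set => iEP; rewrite hv ?mulr0 //.
    move: iEP => /orP[iE|/andP[/andP[iI _] lmi]]; first by left.
    right; split => //.
    have iE : i \notin E by rewrite notin_eqs.
    case/orP: lmi => h; [exists lam => // | exists mu => //].
      by rewrite lt_neqAle eq_sym h lp.
    by rewrite lt_neqAle eq_sym h mp.
  have -> : hessL d2q mu x = hessL d2q lam x + hess d2q (mu - lam) x.
    rewrite /hessL /hess -big_split; apply: eq_bigr => i _ /=.
    by rewrite -scalerDl !mxE [lam i 0 + _]addrC subrK.
  by rewrite mulmxDl vdotDr [X in _ + X]vdotC vnu addr0.
- move=> xs [lam0 /LagrP[l0 e0]].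
  (* The bounded representation of [xs] is again a multiplier at [x], so the graph formula applies
     to it. *)
  have [nu [nc ne nn]] := hc2 x (lt_le_trans hx le4) _ sact _ l0.
  have Lnu : Lagr q dq x xs nu by apply/LagrP; rewrite ne.
  exists nu; split => //.
    apply: le_trans nn _; rewrite e0 ler_wpM2r ?vnorm_ge0 // lerDr.
    exact: ltW.
  by move=> w z; rewrite /gderiv /= (graph _ _ Lnu).
Qed.
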